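(* Let $\beta_c$ be the critical inverse temperature of the three-dimensional nearest-neighbour XY model, and for $n\ge 1$ let $B_n=\{z\in\mathbb{Z}^3:\ |z_k|\le n,\ k=1,2,3\}$. Then $$\lim_{n\to\infty}\frac{1}{|B_n|^2}\sum_{x,y\in B_n}\langle S_x\cdot S_y\rangle_{\beta_c,0}=0 .$$
   Context: Model. For an integer $L\ge1$ let $\Lambda_L=[-L,L]^3\cap\mathbb{Z}^3$, with boundary $\partial\Lambda_L=\{z\in\Lambda_L:\max(|z_1|,|z_2|,|z_3|)=L\}$ and interior $\Lambda_L^o=\Lambda_L\setminus\partial\Lambda_L$. To each $k\in\Lambda_L^o$ is attached a spin $S_k=(\cos\theta_k,\sin\theta_k)\in\mathbb{S}^1$. The coupling is $J_{k,l}=1/6$ if $|k-l|=1$ and $J_{k,l}=0$ otherwise. The Hamiltonian is $H_{L,\nu}=-\sum_{k,l\in\Lambda_L}J_{k,l}\,S_k\cdot S_l$, where the boundary spins are fixed: for the free boundary condition $\nu=0$, $S_k=0$ for $k\in\partial\Lambda_L$; for the plus boundary condition $\nu=+$, $S_k=(1,0)$ for $k\in\partial\Lambda_L$. For a local function $F$ of the spins set $\langle F\rangle_{\beta,\nu,L}=\int\prod_{k\in\Lambda_L^o}d\theta_k\,e^{-\beta H_{L,\nu}}F$, $Z_{\beta,\nu,L}=\langle 1\rangle_{\beta,\nu,L}$, and $\langle F\rangle_{\beta,\nu}=\lim_{L\to\infty}\langle F\rangle_{\beta,\nu,L}/Z_{\beta,\nu,L}$. The magnetization is $m^*(\beta)=\langle\cos\theta_0\rangle_{\beta,+}$,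 and $\beta_c>0$ is the critical inverse temperature: $m^*(\beta)=0$ for $\beta<\beta_c$ and $m^*(\beta)>0$ for $\beta>\beta_c$. *)

(* Defs.v *)
From Stdlib Require Import Reals Lra Lia ZArith List.
From Coquelicot Require Import Coquelicot.
Open Scope R_scope.

Definition site : Type := (Z * Z * Z)%type.

Definition origin : site := (0%Z, 0%Z, 0%Z).

Definition Zrange (n : nat) : list Z :=
  map (fun i => (Z.of_nat i - Z.of_nat n)%Z) (seq 0 (2 * n + 1)).

(** [box n] = { z in Z^3 : |z_k| <= n, k = 1,2,3 } (as a duplicate-free list).
    Lambda_L = box L, and the interior Lambda_L^o = box (L-1). *)
Definition box (n : nat) : list site :=
  flat_map (fun a => flat_map (fun b => map (fun c => (a, b, c)) (Zrange n))
                              (Zrange n)) (Zrange n).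

Definition in_interior (L : nat) (z : site) : bool :=
  match z with (a, b, c) =>
    (Z.abs a <? Z.of_nat L)%Z && (Z.abs b <? Z.of_nat L)%Z && (Z.abs c <? Z.of_nat L)%Z
  end.

Definition J (k l : site) : R :=
  match k, l with (a1, b1, c1), (a2, b2, c2) =>
    if (Z.abs (a1 - a2) + Z.abs (b1 - b2) + Z.abs (c1 - c2) =? 1)%Z
    then 1 / 6 else 0
  end.

Inductive bc : Type := Free | Plus.

Definition spin (L : nat) (nu : bc) (theta : site -> R) (k : site) : R * R :=
  if in_interior L k then (cos (theta k), sin (theta k))
  else match nu with Free => (0, 0) | Plus => (1, 0) end.

Definition dot (u v : R * R) : R := fst u * fst v + snd u * snd v.

Definition sumR {A : Type} (l : list A) (f : A -> R) : R :=
  fold_right (fun a acc => f a + acc) 0 l.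

Definition hamiltonian (L : nat) (nu : bc) (theta : site -> R) : R :=
  - sumR (box L) (fun k => sumR (box L) (fun l =>
        J k l * dot (spin L nu theta k) (spin L nu theta l))).

Definition site_eqb (z w : site) : bool :=
  match z, w with (a1, b1, c1), (a2, b2, c2) =>
    (a1 =? a2)%Z && (b1 =? b2)%Z && (c1 =? c2)%Z
  end.

Definition update (theta : site -> R) (k : site) (t : R) : site -> R :=
  fun z => if site_eqb z k then t else theta z.

Fixpoint integ (sites : list site) (f : (site -> R) -> R) (theta : site -> R) : R :=
  match sites with
  | nil => f theta
  | k :: rest => RInt (fun t => integ rest f (update theta k t)) 0 (2 * PI)
  end.

(** Unnormalised finite-volume expectation <F>_{beta,nu,L}, integrating over
    the interior spins of Lambda_L, L >= 1 (interior of Lambda_L = box (L-1)). *)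
Definition gibbs (beta : R) (nu : bc) (L : nat) (F : (site -> R) -> R) : R :=
  integ (box (L - 1)) (fun theta => exp (- beta * hamiltonian L nu theta) * F theta)
        (fun _ => 0).

Definition partition (beta : R) (nu : bc) (L : nat) : R :=
  gibbs beta nu L (fun _ => 1).

Definition expect (beta : R) (nu : bc) (F : (site -> R) -> R) : R :=
  real (Lim_seq (fun n => gibbs beta nu (S n) F / partition beta nu (S n))).

Definition magnetization (beta : R) : R :=
  expect beta Plus (fun theta => cos (theta origin)).

Definition spin_corr (x y : site) (theta : site -> R) : R :=
  cos (theta x) * cos (theta y) + sin (theta x) * sin (theta y).

(* Main.v *)
From Stdlib Require Import Reals Lra Lia ZArith List Classical FunctionalExtensionality.
From Coquelicot Require Import Coquelicot.
From HB Require Import structures.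
From mathcomp Require Import all_boot all_algebra.
From mathcomp Require Import zify.
Require Import Defs.
Set Implicit Arguments.
Unset Strict Implicit.
Unset Printing Implicit Defensive.
Open Scope R_scope.

(** The angles are discretised to multiples of 2 pi / N with N odd, so that Gibbs states become
    finite sums; Riemann sums recover the integrals as N grows.  Ginibre's inequality bounds the
    free correlations by those of a torus, and the torus correlations of distant spins by the
    magnetization with plus boundary condition, which vanishes below the critical point.
    Reflection positivity of the torus gives Gaussian domination, hence
    E[(sum_e g_e (S_x - S_y))^2] <= |g|^2 / beta: the averages of the spins over a cube of side r
    and over the cube of side 2 r differ by O(r^(-1/2)) in L^2.  Summing over dyadic scales, up to
    cubes whose average is negligible, bounds the mean of the correlations in a cube of side r by
    O(1 / (beta r)), uniformly in the volume; in a fixed finite volume one may let beta increase to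
    the critical value. *)

(** Over a finite group of angles, Ginibre's inequality and reflection positivity both reduce to
    positive definiteness of explicit kernels. Two parities are forced: [N] odd makes 2 invertible,
    and an even torus side lets a reflection exchange equal halves. The infrared bound is used in
    real space: the test field is the indicator of the edges leaving the points of a box in one
    direction, and the [L^2] cost of moving a box of side r by r is of order r / sqrt (r^3 j) = (r
    j)^(-1/2), with j = beta / 6. This decays because the dimension exceeds two, so the dyadic
    series converges. The torus stays finite: its size is chosen after the free volume, the scale at
    which the plus magnetization is small and the large cube, and the bound does not depend on it,
    so on the torus only the number of clock angles tends to infinity. At the critical point no
    limit in beta is taken: one value close to it, depending on the volume, suffices up to a factor
    2, while the bound itself is the same for all volumes. *)

HB.instance Definition _ := Monoid.isComLaw.Build R 0 Rplus
  (fun x y z => esym (Rplus_assoc x y z)) Rplus_comm Rplus_0_l.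
HB.instance Definition _ := Monoid.isMulLaw.Build R 0 Rmult Rmult_0_l Rmult_0_r.
HB.instance Definition _ := Monoid.isAddLaw.Build R Rmult Rplus
  Rmult_plus_distr_r Rmult_plus_distr_l.

Notation "\sum_ ( i <- r ) F" := (\big[Rplus/0]_(i <- r) F) : R_scope.
Notation "\sum_ ( i <- r | P ) F" := (\big[Rplus/0]_(i <- r | P) F) : R_scope.
Notation "\sum_ i F" := (\big[Rplus/0]_i F) : R_scope.
Notation "\sum_ ( i : t ) F" := (\big[Rplus/0]_(i : t) F) (only parsing) : R_scope.
Notation "\sum_ ( i | P ) F" := (\big[Rplus/0]_(i | P) F) : R_scope.
Notation "\sum_ ( i 'in' A ) F" := (\big[Rplus/0]_(i in A) F) : R_scope.
Notation "\sum_ ( i < n ) F" := (\big[Rplus/0]_(i < n) F) : R_scope.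

(** * Finite sums of real numbers *)

Definition b2R (b : bool) : R := if b then 1 else 0.

Lemma b2R_ge0 b : 0 <= b2R b. Proof. by case: b => /=; lra. Qed.

Lemma b2R_le (b c : bool) : (b -> c) -> b2R b <= b2R c.
Proof. by case: b; case: c => //= h; try lra; have := h isT. Qed.

Lemma bsum_ge0 (I : Type) (r : list I) (P : pred I) (F : I -> R) :
  (forall i, P i -> 0 <= F i) -> 0 <= \sum_(i <- r | P i) F i.
Proof. by move=> h; apply: (big_ind (fun x => 0 <= x)) => [|x y|//]; lra. Qed.

Lemma bsum_le (I : Type) (r : list I) (P : pred I) (F G : I -> R) :
  (forall i, P i -> F i <= G i) ->
  \sum_(i <- r | P i) F i <= \sum_(i <- r | P i) G i.
Proof. by move=> h; apply: (big_ind2 (fun x y => x <= y)) => [|x y z t|//]; lra. Qed.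

Lemma bsum_opp (I : Type) (r : list I) (P : pred I) (F : I -> R) :
  \sum_(i <- r | P i) - F i = - \sum_(i <- r | P i) F i.
Proof.
apply: (big_ind2 (fun x y => x = - y)) => [|x y z t -> ->|//]; lra.
Qed.

Lemma bsum_sub (I : Type) (r : list I) (P : pred I) (F G : I -> R) :
  \sum_(i <- r | P i) (F i - G i) = \sum_(i <- r | P i) F i - \sum_(i <- r | P i) G i.
Proof. by rewrite /Rminus big_split /= bsum_opp. Qed.

Lemma bsum_mulr (I : Type) (r : list I) (P : pred I) (F : I -> R) (c : R) :
  c * (\sum_(i <- r | P i) F i) = \sum_(i <- r | P i) c * F i.
Proof. exact: big_distrr. Qed.

Lemma bsum_mull (I : Type) (r : list I) (P : pred I) (F : I -> R) (c : R) :
  (\sum_(i <- r | P i) F i) * c = \sum_(i <- r | P i) F i * c.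
Proof. exact: big_distrl. Qed.

Lemma bsum_mul2 (I J : Type) (r : list I) (s : list J) (F : I -> R) (G : J -> R) :
  (\sum_(i <- r) F i) * (\sum_(j <- s) G j) = \sum_(i <- r) \sum_(j <- s) F i * G j.
Proof. by rewrite bsum_mull; apply: eq_bigr => i _; rewrite bsum_mulr. Qed.

Lemma bsum_const (I : finType) (P : pred I) (c : R) :
  \sum_(i | P i) c = INR #|P| * c.
Proof.
rewrite big_const; elim: #|P| => [|n IH]; first by rewrite /=; lra.
by rewrite S_INR iterS IH; ring.
Qed.

Lemma bsum_delta (I : finType) (j : I) (F : I -> R) :
  \sum_i b2R (i == j) * F i = F j.
Proof.
rewrite (bigD1 j) //= eqxx big1 /b2R => [|i /negbTE ->]; lra.
Qed.

Lemma bsum_b2R (I : finType) (P Q : pred I) (F : I -> R) :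
  \sum_(i | Q i) b2R (P i) * F i = \sum_(i | Q i && P i) F i.
Proof.
rewrite big_mkcondr; apply: eq_bigr => i _; rewrite /b2R; case: (P i); lra.
Qed.

Lemma exp_ge0 x : 0 <= exp x. Proof. by left; apply: exp_pos. Qed.

Lemma is_lim_seq_bsum (I : Type) (r : list I) (P : pred I) (u : nat -> I -> R) (l : I -> R) :
  (forall i, P i -> is_lim_seq (fun n => u n i) (l i)) ->
  is_lim_seq (fun n => \sum_(i <- r | P i) u n i) (\sum_(i <- r | P i) l i).
Proof.
move=> h; elim: r => [|i r IH].
  rewrite big_nil; apply: is_lim_seq_ext (is_lim_seq_const 0) => n.
  by rewrite big_nil.
rewrite big_cons; case Pi: (P i); last first.
  by apply: is_lim_seq_ext IH => n; rewrite big_cons Pi.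
apply: (is_lim_seq_ext (fun n => u n i + \sum_(j <- r | P j) u n j)).
  by move=> n; rewrite big_cons Pi.
by apply: is_lim_seq_plus'; [apply: h|].
Qed.

(** * Positive definite kernels *)

Definition PD (A : finType) (K : A -> A -> R) :=
  forall v : A -> R, 0 <= \sum_a \sum_b v a * v b * K a b.

Section PD.
Variable A : finType.
Implicit Types (K : A -> A -> R) (u : A -> R).

Lemma PD_ext K K' : (forall a b, K a b = K' a b) -> PD K -> PD K'.
Proof.
move=> e h v; have := h v.
by under eq_bigr => a _ do under eq_bigr => b _ do rewrite e.
Qed.

Lemma PD_const1 : PD (fun _ _ : A => 1).
Proof.
move=> v; have -> : \sum_a \sum_b v a * v b * 1 = (\sum_a v a) * (\sum_a v a).
  rewrite bsum_mul2; apply: eq_bigr => a _; apply: eq_bigr => b _; ring.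
exact: Rle_0_sqr.
Qed.

Lemma PD_rank1 K u : PD K -> PD (fun a b => u a * u b * K a b).
Proof.
move=> h v; have := h (fun a => v a * u a); congr (_ <= _).
by apply: eq_bigr => a _; apply: eq_bigr => b _; ring.
Qed.

Lemma PD_scale K c : 0 <= c -> PD K -> PD (fun a b => c * K a b).
Proof.
move=> c0 h v; have := Rmult_le_pos _ _ c0 (h v); congr (_ <= _).
rewrite bsum_mulr; apply: eq_bigr => a _; rewrite bsum_mulr.
by apply: eq_bigr => b _; ring.
Qed.

Lemma PD_sum (I : Type) (r : list I) (K : I -> A -> A -> R) :
  (forall i, PD (K i)) -> PD (fun a b => \sum_(i <- r) K i a b).
Proof.
move=> h v.
have -> : \sum_a \sum_b v a * v b * (\sum_(i <- r) K i a b) =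
  \sum_(i <- r) \sum_a \sum_b v a * v b * K i a b.
  rewrite [RHS]exchange_big /=; apply: eq_bigr => a _.
  rewrite [RHS]exchange_big /=; apply: eq_bigr => b _.
  by rewrite bsum_mulr.
by apply: bsum_ge0 => i _; apply: h.
Qed.

Lemma PD_lim (K : nat -> A -> A -> R) K' :
  (forall n, PD (K n)) -> (forall a b, is_lim_seq (fun n => K n a b) (K' a b)) -> PD K'.
Proof.
move=> h l v.
have hl : is_lim_seq (fun n => \sum_a \sum_b v a * v b * K n a b)
    (\sum_a \sum_b v a * v b * K' a b).
  apply: is_lim_seq_bsum => a _; apply: is_lim_seq_bsum => b _.
  exact: (is_lim_seq_scal_l _ (v a * v b) (K' a b) (l a b)).
exact: (is_lim_seq_le (fun _ => 0) _ 0 _ (fun n => h n v) (is_lim_seq_const 0) hl).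
Qed.

Lemma exp_series x : is_lim_seq (fun n => \sum_(k < n.+1) / INR (fact k) * x ^ k) (exp x).
Proof.
apply: (is_lim_seq_ext (fun n => sum_f_R0 (fun k => / INR (fact k) * x ^ k) n)).
  elim=> [|n IH]; first by rewrite big_ord_recr big_ord0 /=; ring.
  by rewrite big_ord_recr /= -IH.
have /is_pseries_R h := is_exp_Reals x.
have {}h : is_lim_seq (sum_n (fun k => / INR (fact k) * x ^ k)) (exp x) by exact: h.
by apply: is_lim_seq_ext h => n; rewrite sum_n_Reals.
Qed.

(** Each term of the exponential series is a nonnegative multiple of [(u a)^k (u b)^k K a b], a
    rank-one conjugation of [K], and the partial sums converge entrywise. *)
Lemma PD_exp1 K u c : 0 <= c -> PD K -> PD (fun a b => exp (c * (u a * u b)) * K a b).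
Proof.
move=> c0 h.
apply: (@PD_lim (fun n a b => \sum_(k < n.+1) (/ INR (fact k) * c ^ k) *
   (u a ^ k * u b ^ k * K a b))).
  move=> n; apply: PD_sum => k; apply: PD_scale.
    apply: Rmult_le_pos; last exact: pow_le.
    by left; apply: Rinv_0_lt_compat; apply: INR_fact_lt_0.
  exact: (PD_rank1 (fun a => u a ^ k) h).
move=> a b.
have := is_lim_seq_scal_r _ (K a b) _ (@exp_series (c * (u a * u b))).
apply: is_lim_seq_ext => n; rewrite bsum_mull; apply: eq_bigr => k _.
by rewrite !Rpow_mult_distr; ring.
Qed.

Lemma PD_exp (I : Type) (r : list I) (P : pred I) K (u : I -> A -> R) (c : I -> R) :
  (forall i, P i -> 0 <= c i) -> PD K ->
  PD (fun a b => exp (\sum_(i <- r | P i) c i * (u i a * u i b)) * K a b).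
Proof.
move=> c0 h; elim: r => [|i r IH].
  by apply: PD_ext h => a b; rewrite big_nil exp_0 Rmult_1_l.
case Pi: (P i).
  apply: PD_ext (PD_exp1 (u i) (c0 i Pi) IH) => a b.
  by rewrite big_cons Pi exp_plus; ring.
by apply: PD_ext IH => a b; rewrite big_cons Pi.
Qed.

(** Since [-(x - y)^2 = -x^2 - y^2 + 2 x y], a Gaussian kernel is an exponential of products
    conjugated by a rank-one factor. *)
Lemma PD_gauss (I : Type) (r : list I) (P : pred I) K (u : I -> A -> R) (c : I -> R) :
  (forall i, P i -> 0 <= c i) -> PD K ->
  PD (fun a b => exp (- \sum_(i <- r | P i) c i * (u i a - u i b) ^ 2) * K a b).
Proof.
move=> c0 h.
have h2 : PD (fun a b => exp (\sum_(i <- r | P i) 2 * c i * (u i a * u i b)) * K a b).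
  by apply: PD_exp => // i /c0 ?; lra.
apply: PD_ext (PD_rank1 (fun a => exp (- \sum_(i <- r | P i) c i * u i a ^ 2)) h2) => a b.
rewrite -!Rmult_assoc -!exp_plus -!bsum_opp -!big_split /=.
congr (exp _ * _); apply: eq_bigr => i _; ring.
Qed.

(** The indicator of equal images is the sum over [t] of [1[rp a = t] 1[rp b = t]]. The
    representatives [rp] of the fibres of [pi] let this sum run over the finite type [A], as [B] is
    only an [eqType]. *)
Lemma PD_same (B : eqType) (pi : A -> B) K : PD K -> PD (fun a b => b2R (pi a == pi b) * K a b).
Proof.
move=> h.
pose rp (a : A) := odflt a [pick x | pi x == pi a].
have rpP a b : (pi a == pi b) = (rp a == rp b).
  have pr x : pi (rp x) = pi x.
    by rewrite /rp; case: pickP => [y /eqP|] //=.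
  apply/eqP/eqP => [e|e]; last by rewrite -(pr a) e pr.
  rewrite /rp e; case: pickP => [y //|/(_ b)]; by rewrite eqxx.
apply: PD_ext (PD_sum (index_enum A) (fun t => PD_rank1 (fun a => b2R (rp a == t)) h)) => a b.
rewrite -bsum_mull; congr (_ * _); rewrite rpP.
rewrite (eq_bigr (fun t => b2R (t == rp a) * b2R (rp b == t))); last first.
  by move=> t _; rewrite (eq_sym t).
by rewrite bsum_delta eq_sym.
Qed.

End PD.

(** * The clock model and Ginibre's inequality *)

Lemma addr_sub2 (G : zmodType) (x y : G) : (x + y + (x - y) = x + x)%R.
Proof. by rewrite GRing.addrACA GRing.subrr GRing.addr0. Qed.

Section Clock.
Variable q : nat.
Local Notation N := q.+2.
Local Notation T := 'I_N.

Definition ang (x : T) : R := 2 * PI / INR N * INR x.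
Definition cosq (x : T) : R := cos (ang x).
Definition sinq (x : T) : R := sin (ang x).

Lemma ang_modn (n : nat) :
  exists k : nat, 2 * PI / INR N * INR n = ang (inZp n) + 2 * INR k * PI.
Proof.
have h : INR N <> 0 by apply: not_0_INR.
exists (n %/ N)%N; rewrite /ang {1}(divn_eq n N) plus_INR mult_INR.
by have -> : nat_of_ord (inZp n : T) = (n %% N)%N by []; field.
Qed.

Lemma cosqD (x y : T) : cosq (x + y)%R = cosq x * cosq y - sinq x * sinq y.
Proof.
rewrite /cosq /sinq -cos_plus.
have -> : ang x + ang y = 2 * PI / INR N * INR (x + y)%N by rewrite /ang plus_INR; ring.
by have [k ->] := ang_modn (x + y)%N; rewrite cos_period.
Qed.

Lemma sinqD (x y : T) : sinq (x + y)%R = sinq x * cosq y + cosq x * sinq y.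
Proof.
rewrite /cosq /sinq -sin_plus.
have -> : ang x + ang y = 2 * PI / INR N * INR (x + y)%N by rewrite /ang plus_INR; ring.
by have [k ->] := ang_modn (x + y)%N; rewrite sin_period.
Qed.

Lemma ang0 : ang 0%R = 0. Proof. by rewrite /ang /=; ring. Qed.

Lemma cosq0 : cosq 0%R = 1. Proof. by rewrite /cosq ang0 cos_0. Qed.

Lemma sinq0 : sinq 0%R = 0. Proof. by rewrite /sinq ang0 sin_0. Qed.

Lemma cosq_sinq (x : T) : cosq x * cosq x + sinq x * sinq x = 1.
Proof. by have := sin2_cos2 (ang x); rewrite /Rsqr /cosq /sinq; lra. Qed.

Lemma cosq_sinqN (x : T) : cosq (- x)%R = cosq x /\ sinq (- x)%R = - sinq x.
Proof.
have h1 := cosqD x (- x)%R; have h2 := sinqD x (- x)%R; have h3 := cosq_sinq x.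
rewrite GRing.subrr cosq0 in h1; rewrite GRing.subrr sinq0 in h2.
move: (cosq (- x)%R) (sinq (- x)%R) h1 h2 => c s h1 h2; split.
  have -> : cosq x = cosq x * (cosq x * c - sinq x * s) by rewrite -h1; ring.
  have -> : cosq x * (cosq x * c - sinq x * s) =
    (cosq x * cosq x + sinq x * sinq x) * c - sinq x * (sinq x * c + cosq x * s) by ring.
  by rewrite h3 -h2; ring.
have -> : sinq x = sinq x * (cosq x * c - sinq x * s) by rewrite -h1; ring.
have -> : - (sinq x * (cosq x * c - sinq x * s)) =
  (cosq x * cosq x + sinq x * sinq x) * s - cosq x * (sinq x * c + cosq x * s) by ring.
by rewrite h3 -h2; ring.
Qed.

Lemma cosqB (x y : T) : cosq (x - y)%R = cosq x * cosq y + sinq x * sinq y.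
Proof. by rewrite cosqD; have [-> ->] := cosq_sinqN y; ring. Qed.

Lemma cosq_le1 (x : T) : cosq x <= 1.
Proof. by have [] := COS_bound (ang x). Qed.

Hypothesis oddq : odd q.

(** Modulo the odd number [N], [(N + 1) / 2] is an inverse of 2. *)
Lemma double_inj (x y : T) : (x + x = y + y)%R -> x = y.
Proof.
have h (z : T) : ((z + z) *+ (N.+1)./2 = z)%R.
  have -> : ((z + z) = z *+ 2)%R by rewrite GRing.mulr2n.
  rewrite -GRing.mulrnA mul2n.
  have -> : (N.+1)./2.*2 = N.+1 by rewrite -[RHS]odd_double_half /= oddq.
  rewrite GRing.mulrS.
  suff -> : (z *+ N = 0)%R by rewrite GRing.addr0.
  by rewrite Zp_mulrn; apply: val_inj; rewrite /= modnMl.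
by move=> e; rewrite -(h x) -(h y) e.
Qed.

Variable V : finType.
Local Notation X := {ffun V -> T}.

(* For odd N the rotation (a, b) |-> (a + b, a - b) is a bijection; it turns sums over two
   independent copies into sums of kernels in (a, b). *)
Lemma rotate_sum (f g : X -> R) :
  (\sum_s f s) * (\sum_s g s) = \sum_(a : X) \sum_(b : X) f (a + b)%R * g (a - b)%R.
Proof.
rewrite bsum_mul2 !pair_big /=.
rewrite (reindex_inj (h := fun p : X * X => ((p.1 + p.2)%R, (p.1 - p.2)%R))) //=.
move=> [a b] [c d] /= [e1 e2].
have ac : a = c.
  have e : (a + a = c + c)%R by rewrite -(addr_sub2 a b) -(addr_sub2 c d) e1 e2.
  apply/ffunP => v; apply: double_inj.
  by have := congr1 (fun s : X => s v) e; rewrite !ffunE.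
by move: e1; rewrite ac => /GRing.addrI ->.
Qed.

(** Used in two ways: [mask F s == 0] says that the spins in [F] are pinned to angle zero, and
    [mask P s] pins the spins outside [P]. *)
Definition mask (F : pred V) (s : X) : X := [ffun v => if F v then s v else 0%R].

Lemma mask_sub F s t : mask F (s - t)%R = (mask F s - mask F t)%R.
Proof. by apply/ffunP => v; rewrite !ffunE; case: (F v); rewrite ?ffunE ?GRing.subr0. Qed.

(** Raising the couplings from [Jl] to [Jh] and pinning the spins in [F] to zero increases the mean
    of [cosq (chi0 s)]; denominators are cleared. After [rotate_sum] the exponents add up to
    [(Jl + Jh) cos cos + (Jh - Jl) sin sin], the pinning becomes [mask F a = mask F b], and the
    observables differ by [2 sin sin], so the difference of the two sides is twice the total sum of
    a positive definite kernel. *)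
Lemma ginibre (I : finType) (Jl Jh : I -> R) (chi : I -> X -> T) (chi0 : X -> T) (F : pred V) :
  (forall i, 0 <= Jl i <= Jh i) ->
  (forall i a b, chi i (a + b)%R = (chi i a + chi i b)%R) ->
  (forall i a b, chi i (a - b)%R = (chi i a - chi i b)%R) ->
  (forall a b, chi0 (a + b)%R = (chi0 a + chi0 b)%R) ->
  (forall a b, chi0 (a - b)%R = (chi0 a - chi0 b)%R) ->
  let Wl s := exp (\sum_i Jl i * cosq (chi i s)) in
  let Wh s := exp (\sum_i Jh i * cosq (chi i s)) in
  (\sum_s Wl s * cosq (chi0 s)) * (\sum_s b2R (mask F s == 0%R) * Wh s) <=
  (\sum_s Wl s) * (\sum_s b2R (mask F s == 0%R) * (Wh s * cosq (chi0 s))).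
Proof.
move=> hJ chiD chiB chi0D chi0B Wl Wh.
pose K a b := exp (\sum_i (Jl i + Jh i) * (cosq (chi i a) * cosq (chi i b))) *
  (exp (\sum_i (Jh i - Jl i) * (sinq (chi i a) * sinq (chi i b))) *
  (b2R (mask F a == mask F b) * (sinq (chi0 a) * sinq (chi0 b) * 1))).
have hK : PD K.
  apply: PD_exp => [i _|]; first by have := hJ i; lra.
  apply: PD_exp => [i _|]; first by have := hJ i; lra.
  by apply: PD_same; apply: PD_rank1; apply: PD_const1.
apply/Rminus_le_0; rewrite !rotate_sum -bsum_sub.
have /(Rmult_le_pos 2 _ ltac:(lra)) := hK (fun _ => 1); congr (_ <= _).
rewrite bsum_mulr; apply: eq_bigr => a _; rewrite bsum_mulr -bsum_sub.
apply: eq_bigr => b _; rewrite /K mask_sub GRing.subr_eq0.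
rewrite (chi0B a b) (chi0D a b) cosqB cosqD.
have -> : Wl (a + b)%R = exp (\sum_i Jl i * (cosq (chi i a) * cosq (chi i b) - sinq (chi i a) * sinq (chi i b))).
  by congr exp; apply: eq_bigr => i _; rewrite (chiD i a b) cosqD.
have -> : Wh (a - b)%R = exp (\sum_i Jh i * (cosq (chi i a) * cosq (chi i b) + sinq (chi i a) * sinq (chi i b))).
  by congr exp; apply: eq_bigr => i _; rewrite (chiB i a b) cosqB.
set A := exp _; set B := exp _; set C := exp _; set D := exp _.
have e : A * B = C * D.
  rewrite /A /B /C /D -!exp_plus -!big_split /=; congr exp.
  by apply: eq_bigr => i _; ring.
set m := b2R _; set c := cosq (chi0 a); set c' := cosq (chi0 b).
set s := sinq (chi0 a); set s' := sinq (chi0 b).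
by transitivity (2 * m * s * s' * (A * B)); [ring|rewrite e; ring].
Qed.
End Clock.

(** * Reflection positivity and Gaussian domination *)

Section Gauss.
Variables (T V : finType) (p w : T -> R) (adj : rel V) (j : R).
Hypothesis j0 : 0 <= j.
Local Notation X := {ffun V -> T}.

(** For unit spins and [h = 0] this is [j] times one minus their scalar product. The field displaces
    the first component only. *)
Definition pairE (h : R) (s t : T) : R := j / 2 * ((p s - p t - h) ^ 2 + (w s - w t) ^ 2).

Definition gE (h : V -> V -> R) (s : X) : R :=
  \sum_x \sum_(y | adj x y) pairE (h x y) (s x) (s y).

Definition gZ (h : V -> V -> R) : R := \sum_(s : X) exp (- gE h s).

(** The field on the half [H], mirrored to the other half, with the edges across the plane reset to
    [s0]. The value type is general so that codes can be reflected as well as real fields. *)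
Definition refl (S : Type) (rho : V -> V) (H : pred V) (s0 : S) (h : V -> V -> S) (x y : V) : S :=
  if H x then (if H y then h x y else s0) else (if H y then s0 else h (rho x) (rho y)).

Definition reflection (rho : V -> V) (H : pred V) :=
  [/\ involutive rho, forall x, H (rho x) = ~~ H x,
      forall x y, adj (rho x) (rho y) = adj x y &
      forall x y, H x -> ~~ H y -> adj x y || adj y x -> y = rho x].

Section Reflect.
Variables (rho : V -> V) (H : pred V).
Hypothesis hrho : reflection rho H.

Let rhoK : involutive rho. Proof. by have [] := hrho. Qed.
Let rhoH x : H (rho x) = ~~ H x. Proof. by have [] := hrho. Qed.
Let rhoadj x y : adj (rho x) (rho y) = adj x y. Proof. by have [] := hrho. Qed.

Lemma sum_refl (f : V -> R) : \sum_(x | ~~ H x) f x = \sum_(x | H x) f (rho x).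
Proof.
rewrite (reindex_inj (can_inj rhoK)) /=; apply: eq_bigl => x.
by rewrite rhoH negbK.
Qed.

Lemma sum_cross (f : V -> V -> R) x : H x ->
  \sum_(y | adj x y && ~~ H y) f x y = b2R (adj x (rho x)) * f x (rho x).
Proof.
move=> hx; have [_ _ _ h] := hrho.
case a : (adj x (rho x)).
  rewrite (bigD1 (rho x)) /= ?a ?rhoH ?hx // big1 /b2R; first by ring.
  by move=> y /andP[/andP[axy hy] /eqP[]]; apply: h => //; rewrite axy.
rewrite big_pred0 /b2R; first by ring.
move=> y; apply/negP => /andP[axy hy].
by have e := h x y hx hy; rewrite axy in e; move: a; rewrite -e // axy.
Qed.

Lemma sum_crossC (f : V -> V -> R) x : H x ->
  \sum_(y | adj (rho x) y && H y) f (rho x) y = b2R (adj (rho x) x) * f (rho x) x.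
Proof.
move=> hx; have [_ _ _ h] := hrho.
have u y : adj (rho x) y -> H y -> y = x.
  move=> axy hy; have e : rho x = rho y by apply: h => //; rewrite ?rhoH ?hx // axy orbT.
  by rewrite -(rhoK y) -e rhoK.
case a : (adj (rho x) x).
  rewrite (bigD1 x) /= ?a ?hx // big1 /b2R; first by ring.
  by move=> y /andP[/andP[axy hy] /eqP[]]; apply: u.
rewrite big_pred0 /b2R; first by ring.
move=> y; apply/negP => /andP[axy hy].
by have e := u y axy hy; move: axy; rewrite e a.
Qed.

Lemma sum_pairs_split (f : V -> V -> R) :
  \sum_x \sum_(y | adj x y) f x y =
  \sum_(x | H x) \sum_(y | adj x y && H y) f x y +
  \sum_(x | H x) \sum_(y | adj x y && H y) f (rho x) (rho y) +
  \sum_(x | H x) (b2R (adj x (rho x)) * f x (rho x) + b2R (adj (rho x) x) * f (rho x) x).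
Proof.
rewrite (bigID H) /= sum_refl -!big_split /=; apply: eq_bigr => x hx.
have e : \sum_(y | adj (rho x) y && ~~ H y) f (rho x) y =
    \sum_(y | adj x y && H y) f (rho x) (rho y).
  rewrite (reindex_inj (can_inj rhoK)) /=; apply: eq_bigl => y.
  by rewrite rhoadj rhoH negbK.
rewrite (bigID H) /= (sum_cross _ hx) [X in _ + X = _](bigID H) /= (sum_crossC _ hx) e.
ring.
Qed.

Definition glue (a b : X) : X := [ffun x => if H x then a x else b (rho x)].

(** [glue] reads only one half of each argument; the unread halves form another configuration,
    whence the factor [#|X|]. *)
Lemma sum_glue (f : X -> R) :
  \sum_(a : X) \sum_(b : X) f (glue a b) = INR #|X| * \sum_(s : X) f s.
Proof.
have -> : INR #|X| * \sum_s f s = \sum_(s : X) \sum_(t : X) f s.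
  by rewrite bsum_mulr; apply: eq_bigr => s _; rewrite bsum_const.
rewrite !pair_big /= [RHS](reindex_inj (h := fun u : X * X =>
   (glue u.1 u.2, [ffun x => if H x then u.2 (rho x) else u.1 x]))) //=.
move=> [a b] [c d] /= [e1 e2]; congr pair; apply/ffunP => x.
  have := congr1 (fun s : X => s x) e1; have := congr1 (fun s : X => s x) e2.
  by rewrite !ffunE; case: (H x).
have := congr1 (fun s : X => s (rho x)) e1; have := congr1 (fun s : X => s (rho x)) e2.
by rewrite !ffunE rhoH rhoK; case: (H x).
Qed.

Definition halfE (h : V -> V -> R) (a : X) : R :=
  \sum_(x | H x) \sum_(y | adj x y && H y) pairE (h x y) (a x) (a y).

Definition crossE (h : V -> V -> R) (a b : X) : R :=
  \sum_(x | H x) (b2R (adj x (rho x)) * pairE (h x (rho x)) (a x) (b x) +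
                  b2R (adj (rho x) x) * pairE (h (rho x) x) (b x) (a x)).

Lemma gE_glue h a b : gE h (glue a b) =
  halfE h a + halfE (fun x y => h (rho x) (rho y)) b + crossE h a b.
Proof.
rewrite /gE (sum_pairs_split (fun x y => pairE (h x y) (glue a b x) (glue a b y))).
congr (_ + _ + _).
- by apply: eq_bigr => x hx; apply: eq_bigr => y /andP[_ hy]; rewrite !ffunE hx hy.
- apply: eq_bigr => x hx; apply: eq_bigr => y /andP[_ hy].
  by rewrite !ffunE !rhoH hx hy /= !rhoK.
- by apply: eq_bigr => x hx; rewrite !ffunE rhoH hx /= rhoK.
Qed.

Lemma gZ_glue h : INR #|X| * gZ h = \sum_(a : X) \sum_(b : X)
  exp (- halfE h a) * exp (- halfE (fun x y => h (rho x) (rho y)) b) * exp (- crossE h a b).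
Proof.
rewrite -sum_glue; apply: eq_bigr => a _; apply: eq_bigr => b _.
by rewrite gE_glue -!exp_plus; congr exp; ring.
Qed.

Lemma halfE_ext h h' a : (forall x y, H x -> H y -> h x y = h' x y) -> halfE h a = halfE h' a.
Proof.
move=> e; apply: eq_bigr => x hx; apply: eq_bigr => y /andP[_ hy]; by rewrite e.
Qed.

(** The crossing weights between any two half configurations, from the same or from opposite sides,
    as one Gaussian kernel on a disjoint union. The field is absorbed into the coordinates of the
    left copy, so it acts between the copies and cancels within each of them. *)
Definition crossK (h : V -> V -> R) (i k : X + X) : R :=
  let u1 x (i : X + X) := match i with inl a => p (a x) - h x (rho x) | inr b => p (b x) end in
  let u2 x (i : X + X) := match i with inl a => p (a x) + h (rho x) x | inr b => p (b x) end in
  let u3 x (i : X + X) := match i with inl a => w (a x) | inr b => w (b x) end in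
  let c1 x := j / 2 * b2R (adj x (rho x)) in
  let c2 x := j / 2 * b2R (adj (rho x) x) in
  exp (- \sum_(x | H x) c1 x * (u1 x i - u1 x k) ^ 2) *
  (exp (- \sum_(x | H x) c1 x * (u3 x i - u3 x k) ^ 2) *
  (exp (- \sum_(x | H x) c2 x * (u2 x i - u2 x k) ^ 2) *
  (exp (- \sum_(x | H x) c2 x * (u3 x i - u3 x k) ^ 2) * 1))).

Lemma crossK_PD h : PD (crossK h).
Proof.
have c0 b : 0 <= j / 2 * b2R b by apply: Rmult_le_pos; [lra|apply: b2R_ge0].
do 4 (apply: PD_gauss => // ).
exact: PD_const1.
Qed.

Lemma crossK_sym h i k : crossK h i k = crossK h k i.
Proof.
have sq (x y : R) : (x - y) ^ 2 = (y - x) ^ 2 by ring.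
by rewrite /crossK; congr (exp _ * (exp _ * (exp _ * (exp _ * _)))); congr Ropp;
  apply: eq_bigr => x _; rewrite sq.
Qed.

Lemma crossK_same h h' a b : (forall x, H x -> h' x (rho x) = 0 /\ h' (rho x) x = 0) ->
  crossK h (inl a) (inl b) = exp (- crossE h' a b) /\
  crossK h (inr a) (inr b) = exp (- crossE h' a b).
Proof.
move=> h0; rewrite /crossK Rmult_1_r -!exp_plus -!bsum_opp -!big_split /= /crossE.
by split; congr exp; rewrite -?bsum_opp; apply: eq_bigr => x hx; have [-> ->] := h0 x hx;
  rewrite /pairE; ring.
Qed.

Lemma crossK_lr h a b : crossK h (inl a) (inr b) = exp (- crossE h a b).
Proof.
rewrite /crossK Rmult_1_r -!exp_plus -!bsum_opp -!big_split /= /crossE.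
by congr exp; rewrite -?bsum_opp; apply: eq_bigr => x hx; rewrite /pairE; ring.
Qed.

End Reflect.

Variable t0 : T.

(** Cauchy-Schwarz in its arithmetic-mean form for [crossK]: the diagonal blocks produce the
    partition functions of the two reflected fields, the off-diagonal blocks that of [h]. *)
Lemma gZ_refl rho H h : reflection rho H ->
  2 * gZ h <= gZ (refl rho H 0 h) + gZ (refl rho (fun x => ~~ H x) 0 h).
Proof.
move=> hr; have [rhoK rhoH _ _] := hr.
have N0 : 0 < INR #|X|.
  by apply: lt_0_INR; apply/ltP/card_gt0P; exists [ffun=> t0].
apply: (Rmult_le_reg_l _ _ _ N0); rewrite Rmult_plus_distr_l.
rewrite -Rmult_assoc (Rmult_comm _ 2) Rmult_assoc.
rewrite !(gZ_glue hr).
set f := fun a : X => exp (- halfE H h a).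
set g := fun a : X => exp (- halfE H (fun x y => h (rho x) (rho y)) a).
set h1 := refl rho H 0 h; set h2 := refl rho (fun x => ~~ H x) 0 h.
have z1 x : H x -> h1 x (rho x) = 0 /\ h1 (rho x) x = 0.
  by move=> hx; rewrite /h1 /refl rhoH hx.
have z2 x : H x -> h2 x (rho x) = 0 /\ h2 (rho x) x = 0.
  by move=> hx; rewrite /h2 /refl rhoH hx.
have e1 a : halfE H h1 a = halfE H h a.
  by apply: halfE_ext => x y hx hy; rewrite /h1 /refl hx hy.
have e2 a : halfE H (fun x y => h1 (rho x) (rho y)) a = halfE H h a.
  by apply: halfE_ext => x y hx hy; rewrite /h1 /refl !rhoH hx hy /= !rhoK.
have e3 a : halfE H h2 a = halfE H (fun x y => h (rho x) (rho y)) a.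
  by apply: halfE_ext => x y hx hy; rewrite /h2 /refl hx hy.
have e4 a : halfE H (fun x y => h2 (rho x) (rho y)) a = halfE H (fun x y => h (rho x) (rho y)) a.
  by apply: halfE_ext => x y hx hy; rewrite /h2 /refl !rhoH hx hy.
(* Opposite signs on the two copies make the off-diagonal blocks enter as [-2 * E]. *)
have := crossK_PD rho H h (fun i => match i with inl a => f a | inr b => - g b end).
rewrite big_sumType /=.
under eq_bigr => a _ do rewrite big_sumType /=.
under [X in _ + X]eq_bigr => a _ do rewrite big_sumType /=.
rewrite !big_split /=.
set A := \sum_a _; set B := \sum_a _; set C := \sum_a _; set D := \sum_a _ => h0.
have -> : \sum_a \sum_b exp (- halfE H h1 a) * exp (- halfE H (fun x y => h1 (rho x) (rho y)) b) *
   exp (- crossE rho H h1 a b) = A.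
  apply: eq_bigr => a _; apply: eq_bigr => b _.
  by rewrite e1 e2 (crossK_same h a b z1).1.
have -> : \sum_a \sum_b exp (- halfE H h2 a) * exp (- halfE H (fun x y => h2 (rho x) (rho y)) b) *
   exp (- crossE rho H h2 a b) = D.
  apply: eq_bigr => a _; apply: eq_bigr => b _.
  by rewrite e3 e4 (crossK_same h a b z2).2 -/(g a) -/(g b); ring.
set E := \sum_a _.
have eB : B = - E.
  rewrite -bsum_opp; apply: eq_bigr => a _; rewrite -bsum_opp; apply: eq_bigr => b _.
  by rewrite crossK_lr -/(f a) -/(g b); ring.
have eC : C = - E.
  rewrite -eB /C exchange_big; apply: eq_bigr => a _; apply: eq_bigr => b _.
  by rewrite crossK_sym; ring.
by move: h0; rewrite eB eC; lra.
Qed.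

End Gauss.

(** * Gaussian domination from an extremal edge field *)

Lemma finite_max (C : finType) (c0 : C) (F : C -> R) : exists c, forall d, F d <= F c.
Proof.
suff [c h] : exists c, forall d, d \in enum C -> F d <= F c.
  by exists c => d; apply: h; rewrite mem_enum.
elim: (enum C) => [|x s [c h]]; first by exists c0.
case: (Rle_dec (F x) (F c)) => xc.
  by exists c => d; rewrite inE => /orP[/eqP ->|/h].
exists x => d; rewrite inE => /orP[/eqP ->|/h]; lra.
Qed.

Section Domination.
Variables (T V : finType) (p w : T -> R) (adj : rel V) (j : R) (t0 : T).
Hypothesis j0 : 0 <= j.
Hypothesis adj_reflection : forall x y, adj x y ->
  exists rho H, reflection adj rho H /\ H x != H y.
Local Notation X := {ffun V -> T}.
Local Notation code := {ffun V * V -> option (V * V)}.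
Local Notation Z := (gZ p w adj j).

(* Reflections only permute, duplicate or erase the values of an edge field, so the search for a
   maximiser of [Z] can be restricted to the finitely many fields given by codes. *)
Definition field (g : V -> V -> R) (c : code) (x y : V) : R :=
  match c (x, y) with Some e => g e.1 e.2 | None => 0 end.

Definition refl_code rho H (c : code) : code :=
  [ffun e => refl rho H None (fun x y => c (x, y)) e.1 e.2].

Definition nones (c : code) : R := \sum_x \sum_(y | adj x y) b2R (c (x, y) == None).

Lemma gZ_ext h h' : (forall x y, adj x y -> h x y = h' x y) -> Z h = Z h'.
Proof.
move=> e; apply: eq_bigr => s _; congr (exp (- _)).
by apply: eq_bigr => x _; apply: eq_bigr => y a; rewrite e.
Qed.

Lemma field_refl g rho H (c : code) x y :
  field g (refl_code rho H c) x y = refl rho H 0 (field g c) x y.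
Proof. by rewrite /field ffunE /refl /=; case: (H x); case: (H y). Qed.

(** Over the two reflected codes each half is counted twice, so edges inside the halves balance.
    Crossing edges are erased in both, and [(x0, y0)] was not erased before, which makes the gain
    strict. *)
Lemma nones_refl rho H (c : code) x0 y0 : reflection adj rho H -> adj x0 y0 -> H x0 != H y0 ->
  c (x0, y0) <> None ->
  2 * nones c < nones (refl_code rho H c) + nones (refl_code rho (fun x => ~~ H x) c).
Proof.
move=> hr a0 H0 c0; have [rhoK rhoH _ cross] := hr.
rewrite /nones (sum_pairs_split hr (fun x y => b2R (c (x, y) == None))).
rewrite (sum_pairs_split hr (fun x y => b2R (refl_code rho H c (x, y) == None))).
rewrite (sum_pairs_split hr (fun x y => b2R (refl_code rho (fun x => ~~ H x) c (x, y) == None))).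
set A := \sum_(x | H x) \sum_(y | adj x y && H y) b2R (c (x, y) == None).
set B := \sum_(x | H x) \sum_(y | adj x y && H y) b2R (c (rho x, rho y) == None).
set C := \sum_(x | H x) (_ + _).
set A1 := \sum_(x | H x) \sum_(y | adj x y && H y) _.
have -> : A1 = A.
  by apply: eq_bigr => x hx; apply: eq_bigr => y /andP[_ hy]; rewrite ffunE /refl /= hx hy.
set A2 := \sum_(x | H x) \sum_(y | adj x y && H y) _.
have -> : A2 = A.
  apply: eq_bigr => x hx; apply: eq_bigr => y /andP[_ hy].
  by rewrite ffunE /refl /= !rhoH hx hy /= !rhoK.
set B1 := \sum_(x | H x) \sum_(y | adj x y && H y) _.
have -> : B1 = B.
  by apply: eq_bigr => x hx; apply: eq_bigr => y /andP[_ hy]; rewrite ffunE /refl /= hx hy.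
set B2 := \sum_(x | H x) \sum_(y | adj x y && H y) _.
have -> : B2 = B.
  apply: eq_bigr => x hx; apply: eq_bigr => y /andP[_ hy].
  by rewrite ffunE /refl /= !rhoH hx hy /=.
set C1 := \sum_(x | H x) _; set C2 := \sum_(x | H x) _.
pose D := \sum_(x | H x) (b2R (adj x (rho x)) + b2R (adj (rho x) x)).
have -> : C1 = D.
  by apply: eq_bigr => x hx; rewrite !ffunE /refl /= !rhoH hx /=; ring.
have -> : C2 = D.
  by apply: eq_bigr => x hx; rewrite !ffunE /refl /= !rhoH hx /=; ring.
suff : 0 < D - C by lra.
have t01 (a b : bool) : 0 <= b2R a - b2R a * b2R b by case: a; case: b => /=; lra.
have t1 : b2R true - b2R true * b2R false = 1 by rewrite /=; ring.
have cN : (c (x0, y0) == None) = false by apply/eqP.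
have D1 : D - C = \sum_(x | H x) ((b2R (adj x (rho x)) - b2R (adj x (rho x)) * b2R (c (x, rho x) == None)) +
   (b2R (adj (rho x) x) - b2R (adj (rho x) x) * b2R (c (rho x, x) == None))).
  by rewrite /D /C -bsum_sub; apply: eq_bigr => x _; ring.
have term z : H z -> 0 < (b2R (adj z (rho z)) - b2R (adj z (rho z)) * b2R (c (z, rho z) == None)) +
   (b2R (adj (rho z) z) - b2R (adj (rho z) z) * b2R (c (rho z, z) == None)) -> 0 < D - C.
  move=> hz z0; rewrite D1 (bigD1 z) //=; apply: Rplus_lt_le_0_compat => //.
  apply: bsum_ge0 => x _; apply: Rplus_le_le_0_compat; exact: t01.
case hx : (H x0) H0 => H0; case hy : (H y0) H0 => // _.
  have e : y0 = rho x0 by apply: cross => //; rewrite ?hx ?hy ?a0.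
  apply: (term x0) => //; rewrite -e a0 cN t1.
  by have := t01 (adj y0 x0) (c (y0, x0) == None); lra.
have e : x0 = rho y0 by apply: cross => //; rewrite ?hx ?hy ?a0 ?orbT.
apply: (term y0) => //; rewrite -e a0 cN t1.
by have := t01 (adj y0 x0) (c (y0, x0) == None); lra.
Qed.

(** Among the maximising codes, take one that erases the most edges. If some edge kept a value,
    reflect in a plane cutting it: by [gZ_refl] both reflected codes are maximisers too, and by
    [nones_refl] one of them erases more edges. So the extremal field vanishes on all edges. *)
Lemma gaussian_domination g : Z g <= Z (fun _ _ => 0).
Proof.
have [m hm] := finite_max ([ffun=> None] : code) (fun c => Z (field g c)).
(* A lexicographic choice made by one maximisation: [-1] lies below every value of [nones]. *)
pose F c := if Req_EM_T (Z (field g c)) (Z (field g m)) then nones c else -1.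
have F0 c : 0 <= nones c by apply: bsum_ge0 => x _; apply: bsum_ge0 => y _; apply: b2R_ge0.
have [c hc] := finite_max m F.
have F1 d : Z (field g d) = Z (field g m) -> F d = nones d.
  by move=> e; rewrite /F; case: (Req_EM_T (Z (field g d)) (Z (field g m))).
have cm : Z (field g c) = Z (field g m).
  have := hc m; rewrite (F1 m erefl) /F; case: (Req_EM_T (Z (field g c)) (Z (field g m))) => //= _.
  by have := F0 m; lra.
have Fmax d : Z (field g d) = Z (field g m) -> nones d <= nones c.
  by move=> e; rewrite -(F1 d e) -(F1 c cm).
have gm : Z g <= Z (field g m).
  rewrite (_ : Z g = Z (field g [ffun e => Some e])); first exact: hm.
  by apply: gZ_ext => x y _; rewrite /field ffunE.
apply: (Rle_trans _ _ _ gm); rewrite -cm; right; apply: gZ_ext => x y a.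
rewrite /field; case cxy : (c (x, y)) => [e|//]; exfalso.
have [rho [H [hr Hxy]]] := adj_reflection a.
have e1 : Z (field g (refl_code rho H c)) = Z (refl rho H 0 (field g c)).
  by apply: gZ_ext => u v _; rewrite field_refl.
have e2 : Z (field g (refl_code rho (fun x => ~~ H x) c)) = Z (refl rho (fun x => ~~ H x) 0 (field g c)).
  by apply: gZ_ext => u v _; rewrite field_refl.
have := gZ_refl p w j0 t0 (field g c) hr.
rewrite -e1 -e2 cm => h.
have m1 := hm (refl_code rho H c); have m2 := hm (refl_code rho (fun x => ~~ H x) c).
have n1 := Fmax (refl_code rho H c) ltac:(lra).
have n2 := Fmax (refl_code rho (fun x => ~~ H x) c) ltac:(lra).
have cN : c (x, y) <> None by rewrite cxy.
by have := nones_refl hr a Hxy cN; lra.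
Qed.

(** * Infrared bound *)

Hypothesis pw1 : forall t, p t * p t + w t * w t = 1.

Definition W (s : X) : R := exp (j * \sum_x \sum_(y | adj x y) (p (s x) * p (s y) + w (s x) * w (s y))).

Lemma cosh_ge x : 2 + x ^ 2 <= exp x + exp (- x).
Proof.
wlog x0 : x / 0 <= x => [h|].
  case: (Rle_dec 0 x) => hx; first exact: h.
  by have := h (- x) ltac:(lra); rewrite Ropp_involutive; lra.
pose f x := exp x + exp (- x) - 2 - x ^ 2.
pose f' x := exp x - exp (- x) - 2 * x.
have d1 y : is_derive f y (f' y) by rewrite /f /f'; auto_derive => //; ring.
have d2 y : is_derive f' y (exp y + exp (- y) - 2) by rewrite /f'; auto_derive => //; ring.
have pos y : 0 <= exp y + exp (- y) - 2.
  have e : exp y * exp (- y) = 1 by rewrite -exp_plus Rplus_opp_r exp_0.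
  have -> : exp y + exp (- y) - 2 = exp (- y) * (exp y - 1) ^ 2.
    have -> : exp (- y) * (exp y - 1) ^ 2 =
      (exp y * exp (- y)) * exp y - 2 * (exp y * exp (- y)) + exp (- y) by ring.
    by rewrite e; ring.
  by apply: Rmult_le_pos; [apply: exp_ge0|apply: pow2_ge_0].
have f'0 y : 0 <= y -> 0 <= f' y.
  move=> y0; have [z [_ e]] := MVT_gen f' 0 y _ (fun z _ => d2 z)
    (fun z _ => derivable_continuous_pt _ _ (ex_derive_Reals_0 _ _ (ex_intro _ _ (d2 z)))).
  have : f' 0 = 0 by rewrite /f' Ropp_0 exp_0; ring.
  by have := pos z; nra.
have [z [[hz _] e]] := MVT_gen f 0 x _ (fun z _ => d1 z)
    (fun z _ => derivable_continuous_pt _ _ (ex_derive_Reals_0 _ _ (ex_intro _ _ (d1 z)))).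
have e0 : f 0 = 0 by rewrite /f Ropp_0 exp_0; ring.
have : 0 <= f' z by apply: f'0; move: hz; rewrite Rmin_left.
by move: e; rewrite e0 /f; nra.
Qed.

(** From [exp (- x) >= 1 - x], since [(1 - x) (1 + x + 2 x^2) = 1 + x^2 (1 - 2 x) >= 1] on this
    range. *)
Lemma exp_small x : 0 <= x <= / 2 -> exp x <= 1 + x + 2 * x ^ 2.
Proof.
move=> [x0 x1]; have h := exp_ineq1_le (- x).
have e : exp x * exp (- x) = 1 by rewrite -exp_plus Rplus_opp_r exp_0.
have := exp_pos x; nra.
Qed.

Section Infrared.
Variable g : V -> V -> R.
Definition gradient (s : X) : R := j * \sum_x \sum_(y | adj x y) g x y * (p (s x) - p (s y)).
Definition gnorm2 : R := j * \sum_x \sum_(y | adj x y) g x y ^ 2.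

Lemma gE_expand t s : gE p w adj j (fun x y => t * g x y) s =
  j * (\sum_x \sum_(y | adj x y) 1) -
  j * (\sum_x \sum_(y | adj x y) (p (s x) * p (s y) + w (s x) * w (s y))) -
  t * gradient s + t ^ 2 * gnorm2 / 2.
Proof.
rewrite /gradient /gnorm2.
set A := \sum_x \sum_(y | adj x y) 1; set B := \sum_x _; set C := \sum_x _; set D := \sum_x _.
have -> : j * A - j * B - t * (j * C) + t ^ 2 * (j * D) / 2 =
  j * (A - B - t * C + t ^ 2 / 2 * D) by field.
rewrite /gE /A /B /C /D -bsum_sub (bsum_mulr _ _ _ t) -bsum_sub (bsum_mulr _ _ _ (t ^ 2 / 2)).
rewrite -big_split /= bsum_mulr; apply: eq_bigr => x _.
rewrite -bsum_sub (bsum_mulr _ _ _ t) -bsum_sub (bsum_mulr _ _ _ (t ^ 2 / 2)).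
rewrite -big_split /= bsum_mulr; apply: eq_bigr => y _; rewrite /pairE.
have := pw1 (s x); have := pw1 (s y).
move: (p (s x)) (p (s y)) (w (s x)) (w (s y)) => a b c d h1 h2.
have -> : j * (1 - (a * b + c * d) - t * (g x y * (a - b)) + t ^ 2 / 2 * g x y ^ 2) =
  j / 2 * ((a * a + c * c) + (b * b + d * d) - 2 * (a * b + c * d) -
  2 * t * (g x y * (a - b)) + t ^ 2 * g x y ^ 2) by rewrite h1 h2; field.
by field.
Qed.

(** Gaussian domination at the field [t * g]. As the spins have unit length, expanding the squares
    leaves the zero-field energy, a term linear in [gradient] and the constant
    [t^2 * gnorm2 / 2]. *)
Lemma exp_moment t :
  \sum_(s : X) W s * exp (t * gradient s) <= exp (t ^ 2 * gnorm2 / 2) * \sum_(s : X) W s.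
Proof.
pose n := j * \sum_x \sum_(y | adj x y) 1.
have h := gaussian_domination (fun x y => t * g x y).
have e : Z (fun x y => t * g x y) =
  exp (- n - t ^ 2 * gnorm2 / 2) * \sum_(s : X) W s * exp (t * gradient s).
  rewrite bsum_mulr; apply: eq_bigr => s _; rewrite gE_expand /W -!exp_plus -/n.
  by congr exp; ring.
have e0 : Z (fun _ _ => 0) = exp (- n) * \sum_(s : X) W s.
  rewrite (_ : Z _ = Z (fun x y => 0 * g x y)); last by apply: gZ_ext => x y _; ring.
  rewrite bsum_mulr; apply: eq_bigr => s _; rewrite gE_expand /W -!exp_plus -/n.
  by congr exp; rewrite (_ : 0 ^ 2 = 0); [lra|rewrite /=; ring].
rewrite e e0 in h.
apply: (Rmult_le_reg_l (exp (- n - t ^ 2 * gnorm2 / 2))); first exact: exp_pos.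
rewrite -[X in _ <= X]Rmult_assoc -exp_plus.
by have -> : - n - t ^ 2 * gnorm2 / 2 + t ^ 2 * gnorm2 / 2 = - n by ring.
Qed.

(** The second order of [exp_moment] at [t = 0]: adding the bounds at [t] and [-t] cancels the
    linear term, and division by [t^2] leaves an error of order [t^2]. *)
Lemma infrared_bound :
  \sum_(s : X) W s * gradient s ^ 2 <= gnorm2 * \sum_(s : X) W s.
Proof.
set A := \sum_s _; set B := \sum_s _; set G := gnorm2.
have W0 s : 0 < W s by apply: exp_pos.
have B0 : 0 <= B by apply: bsum_ge0 => s _; left.
have G0 : 0 <= G.
  apply: Rmult_le_pos => //; apply: bsum_ge0 => x _; apply: bsum_ge0 => y _; exact: pow2_ge_0.
have step t : 0 < t -> t ^ 2 * G <= 1 -> A <= G * B + t ^ 2 * (G ^ 2 * B).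
  move=> t0' tG.
  have h1 := exp_moment t; have h2 := exp_moment (- t).
  have e : (- t) ^ 2 * gnorm2 / 2 = t ^ 2 * G / 2 by rewrite /G; field.
  rewrite e -/G -/B in h2; rewrite -/G -/B in h1.
  have h3 : 2 * B + t ^ 2 * A <=
    (\sum_s W s * exp (t * gradient s)) + (\sum_s W s * exp (- t * gradient s)).
    rewrite /A /B !bsum_mulr -!big_split /=; apply: bsum_le => s _.
    have -> : - t * gradient s = - (t * gradient s) by ring.
    by have := cosh_ge (t * gradient s); have := W0 s; nra.
  have t2 : 0 < t ^ 2 by apply: pow_lt.
  have tG0 : 0 <= t ^ 2 * G by apply: Rmult_le_pos => //; left.
  have h4 := @exp_small (t ^ 2 * G / 2) ltac:(lra).
  have h5 : exp (t ^ 2 * G / 2) * B <= (1 + t ^ 2 * G / 2 + 2 * (t ^ 2 * G / 2) ^ 2) * B.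
    exact: Rmult_le_compat_r.
  apply: (Rmult_le_reg_l _ _ _ t2).
  have e6 : 2 * ((1 + t ^ 2 * G / 2 + 2 * (t ^ 2 * G / 2) ^ 2) * B) =
    2 * B + t ^ 2 * (G * B + t ^ 2 * (G ^ 2 * B)) by field.
  apply: (Rplus_le_reg_l (2 * B)); rewrite -e6; apply: (Rle_trans _ _ _ h3).
  rewrite (_ : forall x : R, 2 * x = x + x); last by move=> ?; ring.
  by apply: Rplus_le_compat; [apply: Rle_trans h1 h5|apply: Rle_trans h2 h5].
case: (Rle_dec A (G * B)) => // nle; exfalso.
pose d := A - G * B; have d0 : 0 < d by rewrite /d; lra.
have K0 : 0 <= G ^ 2 * B by apply: Rmult_le_pos => //; apply: pow2_ge_0.
(* [u] is the value of [t^2]: the first bound meets the smallness condition of [step], the second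
   keeps the error below half of the supposed excess [d]. *)
pose u := Rmin (/ (G + 1)) (d / (2 * (G ^ 2 * B + 1))).
have u0 : 0 < u.
  by apply: Rmin_glb_lt; [apply: Rinv_0_lt_compat; lra|apply: Rdiv_lt_0_compat; lra].
have su : sqrt u ^ 2 = u by rewrite pow2_sqrt; lra.
have := step (sqrt u) (sqrt_lt_R0 _ u0); rewrite su => h.
have u1 : u * G <= 1.
  apply: (Rle_trans _ (/ (G + 1) * G)); first by apply: Rmult_le_compat_r => //; apply: Rmin_l.
  apply: (Rmult_le_reg_l (G + 1)); first lra.
  rewrite -Rmult_assoc Rinv_r; lra.
have u2 : u * (G ^ 2 * B) <= d / 2.
  apply: (Rle_trans _ (d / (2 * (G ^ 2 * B + 1)) * (G ^ 2 * B))).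
    by apply: Rmult_le_compat_r => //; apply: Rmin_r.
  apply: (Rmult_le_reg_l (2 * (G ^ 2 * B + 1))); first lra.
  have -> : 2 * (G ^ 2 * B + 1) * (d / (2 * (G ^ 2 * B + 1)) * (G ^ 2 * B)) = d * (G ^ 2 * B).
    by field; lra.
  nra.
by have := h u1; rewrite /d in u2 d0; lra.
Qed.

End Infrared.
End Domination.

(** * The discrete torus *)

Section Torus.
Variable m : nat.
Local Notation N := m.+2.
Local Notation V := {ffun 'I_3 -> 'I_N}.

Definition unitv (k : 'I_3) : V := [ffun i => if i == k then 1%R else 0%R].

Definition tadj (x y : V) : bool :=
  [exists k, (y == x + unitv k)%R || (x == y + unitv k)%R].

Lemma tadjC x y : tadj x y = tadj y x.
Proof. by apply: eq_existsb => k; rewrite orbC. Qed.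

Lemma tadj_unit x k : tadj x (x + unitv k)%R.
Proof. by apply/existsP; exists k; rewrite eqxx. Qed.

Lemma val_add1 (a : 'I_N) : nat_of_ord (a + 1)%R = (if a.+1 == N then 0 else a.+1)%N.
Proof.
rewrite /= [(1 %% _)%N]modn_small // addn1.
case: eqP => [->|ne]; first by rewrite modnn.
by rewrite modn_small //; have := ltn_ord a; lia.
Qed.

Lemma val_opp_sub1 (a : 'I_N) : nat_of_ord (- a - 1)%R = (N - 1 - a)%N.
Proof.
rewrite -GRing.opprD; have := val_add1 a; move: (a + 1)%R => b eb.
have -> : nat_of_ord (- b)%R = ((N - b) %% N)%N by [].
rewrite eb; have := ltn_ord a; case: eqP => e h.
  by rewrite subn0 modnn; lia.
by rewrite modn_small; lia.
Qed.

Hypothesis evenm : ~~ odd m.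

Section Plane.
Variables (x0 : V) (k : 'I_3).

(** Coordinate counted from the plane halfway between [x0] and its neighbour in direction [k]. On
    the torus the plane has two sheets: between the values [N - 1] and [0], and between [N/2 - 1]
    and [N/2]. *)
Definition pdist (x : V) : 'I_N := (x k - x0 k - 1)%R.
Definition phalf (x : V) : bool := (pdist x < N./2)%N.
Definition prefl (x : V) : V :=
  [ffun i => if i == k then (x0 k + x0 k + 1 - x k)%R else x i].

Lemma preflK : involutive prefl.
Proof.
move=> x; apply/ffunP => i; rewrite !ffunE eqxx; case: eqP => // ->.
by rewrite GRing.opprB GRing.addrC GRing.subrK.
Qed.

Lemma pdist_prefl x : nat_of_ord (pdist (prefl x)) = (N - 1 - pdist x)%N.
Proof.
rewrite -val_opp_sub1; congr nat_of_ord; rewrite /pdist ffunE eqxx.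
move: (x k) (x0 k) => a b.
have -> : (- (a - b - 1) - 1 = b - a)%R.
  by rewrite GRing.opprB GRing.addrAC GRing.subrr GRing.add0r GRing.opprB.
by rewrite (GRing.addrAC _ (- b)%R) (GRing.addrAC _ (- a)%R) GRing.addrK GRing.addrAC GRing.addrK.
Qed.

Lemma phalf_prefl x : phalf (prefl x) = ~~ phalf x.
Proof.
rewrite /phalf pdist_prefl; have := ltn_ord (pdist x); move: (nat_of_ord _) => d.
have : N = (N./2 + N./2)%N by rewrite addnn -[LHS]odd_double_half /= negbK (negbTE evenm).
lia.
Qed.

Lemma prefl_unit x i : tadj (prefl x) (prefl (x + unitv i)%R).
Proof.
apply/existsP; exists i; case: (altP (i =P k)) => [->|ik].
  apply/orP; right; apply/eqP/ffunP => l; rewrite !ffunE.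
  case: (altP (l =P k)) => [_|lk]; last by rewrite !GRing.addr0.
  by rewrite eqxx GRing.opprD GRing.addrA GRing.subrK.
apply/orP; left; apply/eqP/ffunP => l; rewrite !ffunE.
case: (altP (l =P k)) => [e|lk] //.
by rewrite e (eq_sym k) (negbTE ik) !GRing.addr0.
Qed.

Lemma prefl_adj x y : tadj (prefl x) (prefl y) = tadj x y.
Proof.
have h u v : tadj u v -> tadj (prefl u) (prefl v).
  case/existsP => i /orP[] /eqP ->; first exact: prefl_unit.
  by rewrite tadjC prefl_unit.
by apply/idP/idP; [rewrite -{2}(preflK x) -{2}(preflK y)|]; apply: h.
Qed.

Lemma pdist_unit x i : pdist (x + unitv i)%R = (pdist x + (if i == k then 1 else 0))%R.
Proof.
rewrite /pdist !ffunE eq_sym; case: eqP => _; last by rewrite !GRing.addr0.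
by rewrite (GRing.addrAC (x k)) (GRing.addrAC _ 1%R).
Qed.

(** A unit step changes half only from [N - 1] to [0] or from [N/2 - 1] to [N/2]. Both pairs sum to
    [N - 1], the relation that characterises mirror images by [pdist_prefl]. *)
Lemma prefl_cross_unit x i : phalf x != phalf (x + unitv i)%R ->
  (x + unitv i)%R = prefl x /\ x = prefl (x + unitv i)%R.
Proof.
move=> h; suff e : (x + unitv i)%R = prefl x by rewrite e preflK.
have hk : i = k.
  by move: h; rewrite /phalf pdist_unit; case: (i =P k) => //; rewrite GRing.addr0 eqxx.
subst i; have hN : N = (N./2 + N./2)%N.
  by rewrite addnn -[LHS]odd_double_half /= negbK (negbTE evenm).
have e : nat_of_ord (pdist (x + unitv k)%R) = (N - 1 - pdist x)%N.
  move: h; rewrite /phalf pdist_unit eqxx val_add1; have := ltn_ord (pdist x).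
  by move: (nat_of_ord (pdist x)) => d; case: (d.+1 =P N); case: (ltnP d N./2); case: ltnP => //=; lia.
rewrite -pdist_prefl in e; move/val_inj: e => e.
apply/ffunP => l; case: (altP (l =P k)) => [->|lk].
  by move: e; rewrite /pdist => /GRing.addIr /GRing.addIr.
by rewrite !ffunE (negbTE lk) GRing.addr0.
Qed.

Lemma prefl_reflection : reflection tadj prefl phalf.
Proof.
split; [exact: preflK|exact: phalf_prefl|exact: prefl_adj|move=> x y hx hy].
rewrite tadjC orbb => /existsP[i /orP[] /eqP e].
  by have := @prefl_cross_unit y i; rewrite -e hx (negbTE hy) => /(_ isT)[].
by have := @prefl_cross_unit x i; rewrite -e hx (negbTE hy) => /(_ isT)[].
Qed.
End Plane.

(** The plane through the midpoint of the edge gives its endpoints the [pdist] values [N - 1] and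
    [0]. *)
Lemma torus_reflection x y : tadj x y ->
  exists rho H, reflection tadj rho H /\ H x != H y.
Proof.
have h u k : phalf u k u != phalf u k (u + unitv k)%R.
  rewrite /phalf pdist_unit eqxx /pdist GRing.subrr GRing.add0r.
  rewrite GRing.addNr; have := val_opp_sub1 0%R; rewrite GRing.oppr0 GRing.add0r => ->.
  rewrite /=; have : N = (N./2 + N./2)%N by rewrite addnn -[LHS]odd_double_half /= negbK (negbTE evenm).
  by case: leqP => //; lia.
case/existsP => k /orP[] /eqP ->.
  by exists (prefl x k), (phalf x k); split; [exact: prefl_reflection|exact: h].
by exists (prefl y k), (phalf y k); split; [exact: prefl_reflection|rewrite eq_sym; exact: h].
Qed.
End Torus.

(** * Block averages *)

Section Box.
Variable m : nat.
Local Notation N := m.+2.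
Local Notation V := {ffun 'I_3 -> 'I_N}.

Definition pt (a b c : nat) : V :=
  [ffun l : 'I_3 => inZp (match nat_of_ord l with 0%N => a | 1%N => b | _ => c end)].

Lemma inZpD (a b : nat) : (inZp (a + b) = inZp a + inZp b :> 'I_N)%R.
Proof. by apply: val_inj; rewrite /= modnDm. Qed.

Lemma inZp_inj (a b : nat) : (a < N)%N -> (b < N)%N -> inZp a = inZp b :> 'I_N -> a = b.
Proof. by move=> ha hb /(congr1 val) /=; rewrite !modn_small. Qed.

Lemma ord3P (l : 'I_3) : [\/ l = inord 0, l = inord 1 | l = inord 2].
Proof.
by case: l => -[|[|[|//]]] h; [apply: Or31|apply: Or32|apply: Or33]; apply: val_inj; rewrite /= inordK.
Qed.

Lemma unitv_mul k n l : (unitv m k *+ n)%R l = (if l == k then inZp n else 0)%R.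
Proof.
rewrite ffunMnE ffunE; case: eqP => _; last by rewrite GRing.mul0rn.
by rewrite Zp_nat.
Qed.

Lemma inordE (i k : nat) (l : 'I_3) : (i < 3)%N -> nat_of_ord l = k -> (l == inord i) = (k == i).
Proof. by move=> hi <-; rewrite -val_eqE /= inordK. Qed.

Lemma pt_shift a b c n :
  [/\ (pt (n + a) b c = pt a b c + unitv m (inord 0) *+ n)%R,
      (pt a (n + b) c = pt a b c + unitv m (inord 1) *+ n)%R &
      (pt a b (n + c) = pt a b c + unitv m (inord 2) *+ n)%R].
Proof.
by split; apply/ffunP => l; rewrite !ffunE unitv_mul (inordE _ (erefl (nat_of_ord l))) //;
  case: l => -[|[|[|//]]] h; rewrite /= ?GRing.addr0 // inZpD GRing.addrC.
Qed.

Definition bxsum (a b c : nat) (u : V -> R) : R :=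
  \sum_(i < a) \sum_(j < b) \sum_(k < c) u (pt i j k).

Lemma bxsum_double a b c u :
  [/\ bxsum (a + a) b c u = bxsum a b c u + bxsum a b c (fun v => u (v + unitv m (inord 0) *+ a)%R),
      bxsum a (b + b) c u = bxsum a b c u + bxsum a b c (fun v => u (v + unitv m (inord 1) *+ b)%R) &
      bxsum a b (c + c) u = bxsum a b c u + bxsum a b c (fun v => u (v + unitv m (inord 2) *+ c)%R)].
Proof.
rewrite /bxsum; split.
- rewrite big_split_ord /=; congr (_ + _).
  apply: eq_bigr => i _; apply: eq_bigr => j _; apply: eq_bigr => k _.
  by have [-> _ _] := pt_shift i j k a.
- rewrite -big_split /=; apply: eq_bigr => i _; rewrite big_split_ord /=; congr (_ + _).
  apply: eq_bigr => j _; apply: eq_bigr => k _.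
  by have [_ -> _] := pt_shift i j k b.
- rewrite -big_split /=; apply: eq_bigr => i _; rewrite -big_split /=; apply: eq_bigr => j _.
  rewrite big_split_ord /=; congr (_ + _); apply: eq_bigr => k _.
  by have [_ _ ->] := pt_shift i j k c.
Qed.

Local Notation idx a b c := ('I_a * 'I_b * 'I_c)%type.
Definition ptI a b c (t : idx a b c) : V := pt t.1.1 t.1.2 t.2.

Lemma bxsumE a b c u : bxsum a b c u = \sum_(t : idx a b c) u (ptI t).
Proof. by rewrite /bxsum !pair_big. Qed.

Lemma ptI_inj a b c : (a <= N)%N -> (b <= N)%N -> (c <= N)%N -> injective (@ptI a b c).
Proof.
move=> ha hb hc [[i j] k] [[i' j'] k'] e.
have h l := congr1 (fun s : V => s l) e; move: h => /= h.
have := h (inord 0); have := h (inord 1); have := h (inord 2).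
rewrite !ffunE !inordK //=.
have lt d (x : 'I_d) : (d <= N)%N -> (x < N)%N by move=> h'; apply: leq_trans h'.
move=> /inZp_inj e1 /inZp_inj e2 /inZp_inj e3.
by congr (_, _, _); apply: val_inj; [apply: e3|apply: e2|apply: e1]; apply: lt.
Qed.

Variables (T : finType) (j : R) (t0 : T).
Hypothesis evenm : ~~ odd m.
Hypothesis jpos : 0 < j.
Local Notation X := {ffun V -> T}.

Section Component.
Variables (p w : T -> R).
Hypothesis pw1 : forall t, p t * p t + w t * w t = 1.
Local Notation W := (W p w (@tadj m) j).

(** An [L^2] norm bound in the Gibbs state, written without normalisation. Positivity of [al] makes
    the quotients in [bnd_add] meaningful. *)
Definition bnd (f : X -> R) (al : R) :=
  0 < al /\ \sum_(s : X) W s * f s ^ 2 <= al ^ 2 * \sum_(s : X) W s.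

Lemma W_ge0 s : 0 <= W s. Proof. exact: exp_ge0. Qed.

Lemma bnd_ext f g al : (forall s, f s = g s) -> bnd f al -> bnd g al.
Proof. by move=> e [a0 h]; split=> //; under eq_bigr => s _ do rewrite -e. Qed.

(** The triangle inequality in [L^2], through the weighted Young inequality with weights [be / al]
    and [al / be], which reproduce exactly [(al + be)^2]. *)
Lemma bnd_add f g al be : bnd f al -> bnd g be -> bnd (fun s => f s + g s) (al + be).
Proof.
move=> [a0 hf] [b0 hg]; split; first lra.
set B := \sum_s W s in hf hg *.
apply: (Rle_trans _ ((1 + be / al) * (\sum_s W s * f s ^ 2) + (1 + al / be) * (\sum_s W s * g s ^ 2))).
  rewrite !bsum_mulr -big_split /=; apply: bsum_le => s _.
  have -> : (1 + be / al) * (W s * f s ^ 2) + (1 + al / be) * (W s * g s ^ 2) =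
    W s * (f s + g s) ^ 2 + W s * ((be * f s - al * g s) ^ 2 * / (al * be)) by field; lra.
  rewrite -[X in X <= _]Rplus_0_r; apply: Rplus_le_compat_l.
  apply: Rmult_le_pos; first exact: W_ge0.
  apply: Rmult_le_pos; first exact: pow2_ge_0.
  by left; apply: Rinv_0_lt_compat; nra.
have -> : (al + be) ^ 2 * B = (1 + be / al) * (al ^ 2 * B) + (1 + al / be) * (be ^ 2 * B) by field; lra.
have c1 : 0 <= 1 + be / al by have := Rdiv_lt_0_compat _ _ b0 a0; lra.
have c2 : 0 <= 1 + al / be by have := Rdiv_lt_0_compat _ _ a0 b0; lra.
by apply: Rplus_le_compat; apply: Rmult_le_compat_l.
Qed.

Lemma bnd_scale f al c : 0 < c -> bnd f al -> bnd (fun s => c * f s) (c * al).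
Proof.
move=> c0 [a0 h]; split; first nra.
have -> : \sum_s W s * (c * f s) ^ 2 = c ^ 2 * \sum_s W s * f s ^ 2.
  by rewrite bsum_mulr; apply: eq_bigr => s _; ring.
rewrite Rpow_mult_distr Rmult_assoc; apply: Rmult_le_compat_l => //; exact: pow2_ge_0.
Qed.

Lemma bnd_weak f al be : al <= be -> bnd f al -> bnd f be.
Proof.
move=> ab [a0 h]; split; first lra.
apply: (Rle_trans _ _ _ h); apply: Rmult_le_compat_r; last nra.
by apply: bsum_ge0 => s _; apply: W_ge0.
Qed.

Section Shift.
Variables (I : finType) (k : 'I_3).
Hypothesis I0 : (0 < #|I|)%N.

(** The infrared bound for the field equal to 1 on the ordered pairs [(tau i, tau i + unitv m k)]
    and 0 elsewhere. By injectivity its squared norm is [j * #|I|]; the gradient carries a factor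
    [j], so the second moment is at most [#|I| / j]. *)
Lemma bnd_shift1 (tau : I -> V) : injective tau ->
  bnd (fun s => \sum_i (p (s (tau i)) - p (s (tau i + unitv m k)%R))) (sqrt (INR #|I| / j)).
Proof.
move=> inj.
have n0 : 0 < INR #|I| by apply: lt_0_INR; apply/ltP.
have nj : 0 < INR #|I| / j by apply: Rdiv_lt_0_compat.
split; first exact: sqrt_lt_R0.
rewrite pow2_sqrt; last lra.
pose S := [set tau i | i in I].
have sumS (u : V -> R) : \sum_(x | x \in S) u x = \sum_i u (tau i).
  by rewrite big_imset //= => x y _ _; apply: inj.
pose g (x y : V) := b2R ((x \in S) && (y == x + unitv m k)%R).
have red (u : V -> V -> R) : \sum_x \sum_(y | tadj x y) g x y * u x y =
    \sum_i u (tau i) (tau i + unitv m k)%R.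
  rewrite -(sumS (fun x => u x (x + unitv m k)%R)) [RHS]big_mkcond.
  apply: eq_bigr => x _; rewrite bsum_b2R; case: (x \in S) => /=.
    rewrite (big_pred1 (x + unitv m k)%R) // => y /=.
    by case: eqP => [->|_]; rewrite ?tadj_unit ?andbF.
  by rewrite big_pred0 // => y; rewrite andbF.
have := infrared_bound t0 (Rlt_le _ _ jpos) (torus_reflection evenm) pw1 g.
have -> : gnorm2 (@tadj m) j g = j * INR #|I|.
  congr (_ * _); rewrite (_ : INR #|I| = \sum_(i : I) 1); last by rewrite bsum_const Rmult_1_r.
  rewrite -(red (fun _ _ => 1)); apply: eq_bigr => x _; apply: eq_bigr => y _.
  by rewrite /g /b2R; case: (_ && _) => /=; lra.
have e s : gradient p (@tadj m) j g s = j * \sum_i (p (s (tau i)) - p (s (tau i + unitv m k)%R)).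
  by rewrite /gradient (red (fun x y => p (s x) - p (s y))).
under eq_bigr => s _ do rewrite e.
set B := \sum_s W s; set A := \sum_s _ => h.
have pull (a b c : R) : b * (a * c) ^ 2 = a ^ 2 * (b * c ^ 2) by ring.
have eA : A = j ^ 2 * \sum_(s : X) W s * (\sum_i (p (s (tau i)) - p (s (tau i + unitv m k)%R))) ^ 2.
  rewrite bsum_mulr; apply: eq_bigr => s _; exact: pull.
rewrite eA in h; apply: (Rmult_le_reg_l (j ^ 2)); first by apply: pow_lt.
by have -> : j ^ 2 * (INR #|I| / j * B) = j * INR #|I| * B by field; lra.
Qed.
(** Telescoping over unit steps: every translate of [tau] is injective, so each step costs the
    same. *)
Lemma bnd_shift (tau : I -> V) n : injective tau -> (0 < n)%N ->
  bnd (fun s => \sum_i (p (s (tau i)) - p (s (tau i + unitv m k *+ n)%R)))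
      (INR n * sqrt (INR #|I| / j)).
Proof.
move=> inj; elim: n => // n IH _; case: (posnP n) => [->|n0].
  rewrite Rmult_1_l; exact: (bnd_shift1 inj).
rewrite S_INR Rmult_plus_distr_r Rmult_1_l.
have inj' : injective (fun i => tau i + unitv m k *+ n)%R by move=> x y /GRing.addIr /inj.
apply: bnd_ext (bnd_add (IH n0) (bnd_shift1 inj')) => s.
rewrite -big_split /=; apply: eq_bigr => i _.
rewrite GRing.mulrSr GRing.addrA.
have tele (a b c : R) : a - b + (b - c) = a - c by ring.
exact: tele.
Qed.

(** The average over one half of a doubled block is the average over the whole plus half the
    difference between the two half averages; [bnd_shift] controls the latter. *)
Lemma bnd_double (tau : I -> V) n al : injective tau -> (0 < n)%N ->
  bnd (fun s => / (2 * INR #|I|) *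
    ((\sum_i p (s (tau i))) + \sum_i p (s (tau i + unitv m k *+ n)%R))) al ->
  bnd (fun s => / INR #|I| * \sum_i p (s (tau i))) (al + INR n / (2 * sqrt (INR #|I| * j))).
Proof.
move=> inj n0 h.
have c0 : 0 < INR #|I| by apply: lt_0_INR; apply/ltP.
have c1 : 0 < / (2 * INR #|I|) by apply: Rinv_0_lt_compat; lra.
have h2 := bnd_scale c1 (bnd_shift inj n0).
have e : / (2 * INR #|I|) * (INR n * sqrt (INR #|I| / j)) = INR n / (2 * sqrt (INR #|I| * j)).
  have s0 : 0 < sqrt (INR #|I| * j) by apply: sqrt_lt_R0; nra.
  have -> : INR #|I| / j = (INR #|I| * j) * / j ^ 2 by field; lra.
  rewrite sqrt_mult; [|nra|by left; apply: Rinv_0_lt_compat; nra].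
  rewrite sqrt_inv sqrt_pow2; last lra.
  have := sqrt_sqrt (INR #|I| * j) ltac:(nra); move: (sqrt _) s0 => r r0 hr.
  apply: (Rmult_eq_reg_r (r * (2 * INR #|I| * j))); last by apply: Rgt_not_eq; repeat apply: Rmult_lt_0_compat; lra.
  transitivity (INR n * (r * r)); first by field; lra.
  by rewrite hr; field; lra.
rewrite e in h2; apply: bnd_ext (bnd_add h h2) => s.
rewrite bsum_sub; field; lra.
Qed.
End Shift.

Definition block (a b c : nat) (s : X) : R :=
  / INR (a * b * c) * bxsum a b c (fun v => p (s v)).

Lemma card_idx a b c : #|{: idx a b c}| = (a * b * c)%N.
Proof. by rewrite !card_prod !card_ord. Qed.

Lemma block_double a b c : (0 < a)%N -> (0 < b)%N -> (0 < c)%N ->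
  (a <= N)%N -> (b <= N)%N -> (c <= N)%N ->
  [/\ forall al, bnd (block (a + a) b c) al -> bnd (block a b c) (al + INR a / (2 * sqrt (INR (a * b * c) * j))),
      forall al, bnd (block a (b + b) c) al -> bnd (block a b c) (al + INR b / (2 * sqrt (INR (a * b * c) * j))) &
      forall al, bnd (block a b (c + c)) al -> bnd (block a b c) (al + INR c / (2 * sqrt (INR (a * b * c) * j)))].
Proof.
move=> a0 b0 c0 ha hb hc.
have inj := ptI_inj ha hb hc.
have I0 : (0 < #|{: idx a b c}|)%N by rewrite card_idx !muln_gt0 a0 b0 c0.
have e (s : X) : / INR #|{: idx a b c}| * (\sum_(t : idx a b c) p (s (ptI t))) = block a b c s.
  by rewrite /block bxsumE card_idx.
have two : 2 * INR (a * b * c) = INR (a * b * c + a * b * c) by rewrite plus_INR; ring.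
by split => al h; rewrite -card_idx; apply: bnd_ext e _; apply: bnd_double => //;
  (apply: bnd_ext h => s; rewrite /block card_idx two; congr (/ INR _ * _);
   [lia|have [h1 h2 h3] := bxsum_double a b c (fun v => p (s v)); rewrite ?h1 ?h2 ?h3;
    congr (_ + _); exact: bxsumE]).
Qed.

Definition kap (r : nat) : R := / sqrt (INR r * j).

Lemma sqrt_kap r a : (0 < r)%N -> (r * r * r <= a)%N ->
  INR r / (2 * sqrt (INR a * j)) <= kap r / 2.
Proof.
move=> r0 ha; rewrite /kap.
have R0 : 0 < INR r by apply: lt_0_INR; apply/ltP.
have Rj : 0 < INR r * j by nra.
have s0 : 0 < sqrt (INR r * j) by apply: sqrt_lt_R0.
have le : INR r * sqrt (INR r * j) <= sqrt (INR a * j).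
  rewrite -{1}(sqrt_pow2 (INR r)); last lra.
  rewrite -sqrt_mult; [|nra|nra]; apply: sqrt_le_1_alt.
  have -> : INR r ^ 2 * (INR r * j) = INR (r * r * r) * j by rewrite !mult_INR; ring.
  by apply: Rmult_le_compat_r; [lra|apply: le_INR; apply/leP].
have q0 : 0 < sqrt (INR a * j) by nra.
have -> : / sqrt (INR r * j) / 2 = INR r / (2 * (INR r * sqrt (INR r * j))) by field; lra.
apply: Rmult_le_compat_l; first lra.
by apply Rinv_le_contravar; nra.
Qed.

(** The directions are halved one at a time. Each halving costs at most [kap r / 2], because the
    block that is kept has volume at least [r^3]. *)
Lemma block_cube_double r al : (0 < r)%N -> (r + r <= N)%N ->
  bnd (block (r + r) (r + r) (r + r)) al -> bnd (block r r r) (al + 3 / 2 * kap r).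
Proof.
move=> r0 hr h.
have hr1 : (r <= N)%N by lia.
have r20 : (0 < r + r)%N by lia.
have [_ _ f3] := @block_double (r + r) (r + r) r r20 r20 r0 hr hr hr1.
have h3 := f3 _ h; have [_ f2 _] := @block_double (r + r) r r r20 r0 r0 hr hr1 hr1.
have h2 := f2 _ h3; have [f1 _ _] := @block_double r r r r0 r0 r0 hr1 hr1 hr1.
have h1 := f1 _ h2.
apply: bnd_weak h1.
have := @sqrt_kap r (r * r * r) r0 (leqnn _).
have := @sqrt_kap r ((r + r) * r * r) r0 ltac:(nia).
have := @sqrt_kap r ((r + r) * (r + r) * r) r0 ltac:(nia).
lra.
Qed.

(** The true ratio [1 / sqrt 2] is rounded up to [3 / 4]. With a cost of [3 / 2 * kap r] per
    doubling, the geometric series then sums to [6 * kap r]. *)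
Lemma kap_double r : (0 < r)%N -> kap (r + r) <= 3 / 4 * kap r.
Proof.
move=> r0; rewrite /kap plus_INR.
have R0 : 0 < INR r by apply: lt_0_INR; apply/ltP.
have -> : (INR r + INR r) * j = 2 * (INR r * j) by ring.
rewrite sqrt_mult; [|lra|nra].
have s0 : 0 < sqrt (INR r * j) by apply: sqrt_lt_R0; nra.
have s2 : 4 / 3 <= sqrt 2 by rewrite -(sqrt_pow2 (4 / 3)); [apply: sqrt_le_1_alt; lra|lra].
have -> : 3 / 4 * / sqrt (INR r * j) = / (4 / 3 * sqrt (INR r * j)) by field; lra.
by apply Rinv_le_contravar; nra.
Qed.

(* The increments at side [2^i r] decay geometrically, by [kap_double]. *)
Lemma block_dyadic K r al : (0 < r)%N -> (2 ^ K * r <= N)%N ->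
  bnd (block (2 ^ K * r) (2 ^ K * r) (2 ^ K * r)) al -> bnd (block r r r) (al + 6 * kap r).
Proof.
elim: K r => [|K IH] r r0 hK h.
  rewrite mul1n in h; apply: bnd_weak h.
  have : 0 < kap r by apply: Rinv_0_lt_compat; apply: sqrt_lt_R0; apply: Rmult_lt_0_compat => //;
    apply: lt_0_INR; apply/ltP.
  lra.
have e : (2 ^ K.+1 * r = 2 ^ K * (r + r))%N by rewrite expnSr -mulnA mul2n addnn.
rewrite e in hK h.
have h1 := IH (r + r)%N ltac:(lia) hK h.
have K1 : (0 < 2 ^ K)%N by rewrite expn_gt0.
have h2 := block_cube_double r0 ltac:(nia) h1.
by apply: bnd_weak h2; have := kap_double r0; lra.
Qed.

End Component.

Variables (p w : T -> R).
Hypothesis pw1 : forall t, p t * p t + w t * w t = 1.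
Local Notation W0 := (W p w (@tadj m) j).

Definition corr (x y : V) : R := \sum_(s : X) W0 s * (p (s x) * p (s y) + w (s x) * w (s y)).

Lemma block_sq (u : T -> R) r (s : X) :
  block u r r r s ^ 2 = / INR (r * r * r) ^ 2 *
  \sum_(t : idx r r r) \sum_(t' : idx r r r) u (s (ptI t)) * u (s (ptI t')).
Proof.
rewrite /block bxsumE Rpow_mult_distr pow_inv; congr (_ * _).
by rewrite -bsum_mul2 /=; ring.
Qed.

Lemma block_corr r :
  (\sum_(s : X) W0 s * block p r r r s ^ 2) + (\sum_(s : X) W0 s * block w r r r s ^ 2) =
  / INR (r * r * r) ^ 2 * \sum_(t : idx r r r) \sum_(t' : idx r r r) corr (ptI t) (ptI t').
Proof.
rewrite bsum_mulr.
transitivity (\sum_(s : X) \sum_(t : idx r r r) \sum_(t' : idx r r r) / INR (r * r * r) ^ 2 *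
  (W0 s * (p (s (ptI t)) * p (s (ptI t')) + w (s (ptI t)) * w (s (ptI t'))))).
  rewrite -big_split; apply: eq_bigr => s _; rewrite -[LHS]Rmult_plus_distr_l !block_sq.
  rewrite -Rmult_plus_distr_l -big_split !bsum_mulr; apply: eq_bigr => t _.
  rewrite -[X in _ * (_ * X)]big_split !bsum_mulr; apply: eq_bigr => t' _ /=.
  by rewrite -!Rmult_assoc (Rmult_comm (W0 _)).
rewrite exchange_big /=; apply: eq_bigr => t _; rewrite bsum_mulr exchange_big /=.
by apply: eq_bigr => t' _; rewrite /corr bsum_mulr.
Qed.

(** Gaussian domination displaces the first component only, so the dyadic bound is applied once more
    with [p] and [w] exchanged, which leaves the weight unchanged. Adding the two components gives
    the factor 2. *)
Lemma torus_average K r al : (0 < r)%N -> (2 ^ K * r <= N)%N -> 0 < al ->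
  let M := (2 ^ K * r)%N in
  / INR (M * M * M) ^ 2 * (\sum_(t : idx M M M) \sum_(t' : idx M M M) corr (ptI t) (ptI t')) <=
    al ^ 2 * \sum_(s : X) W0 s ->
  / INR (r * r * r) ^ 2 * (\sum_(t : idx r r r) \sum_(t' : idx r r r) corr (ptI t) (ptI t')) <=
    2 * (al + 6 * kap r) ^ 2 * \sum_(s : X) W0 s.
Proof.
move=> r0 hK al0 M; rewrite -!block_corr => h.
have pos (u : T -> R) : 0 <= \sum_(s : X) W0 s * block u M M M s ^ 2.
  by apply: bsum_ge0 => s _; apply: Rmult_le_pos; [apply: exp_ge0|apply: pow2_ge_0].
have bp : bnd p w (block p M M M) al by split=> //; have := pos w; lra.
have wp1 t : w t * w t + p t * p t = 1 by have := pw1 t; lra.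
have eW : W w p (@tadj m) j = W p w (@tadj m) j.
  apply: functional_extensionality => s; rewrite /W; congr (exp (_ * _)).
  apply: eq_bigr => x _; apply: eq_bigr => y _; ring.
have bw : bnd w p (block w M M M) al.
  split=> //; rewrite eW; have := pos p.
  move: h; set A := \sum_s _; set B := \sum_s _; set C := \sum_s _ => h0 h1.
  by apply: Rle_trans h0; rewrite -[X in X <= _]Rplus_0_l; apply: Rplus_le_compat_r.
have [_ h1] := block_dyadic pw1 r0 hK bp.
have [_ h2] := block_dyadic wp1 r0 hK bw.
rewrite eW in h2.
apply: (Rle_trans _ _ _ (Rplus_le_compat _ _ _ _ h1 h2)).
by right; ring.
Qed.

End Box.

(** * Riemann sums for iterated integrals *)

Lemma Rabs_bsum (I : Type) (r : list I) (P : pred I) (F : I -> R) :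
  Rabs (\sum_(i <- r | P i) F i) <= \sum_(i <- r | P i) Rabs (F i).
Proof.
apply: (big_ind2 (fun x y => Rabs x <= y)) => [|x y z t h1 h2|i _]; last lra.
  by rewrite Rabs_R0; lra.
by apply: (Rle_trans _ _ _ (Rabs_triang _ _)); lra.
Qed.

Definition lip1 (K : R) (g : R -> R) := forall s t, Rabs (g s - g t) <= K * Rabs (s - t).

Lemma lip1_continuous K g t : 0 <= K -> lip1 K g -> continuous g t.
Proof.
move=> K0 h; apply/continuity_pt_filterlim => e e0.
exists (e / (K + 1)); split; first by apply: Rdiv_lt_0_compat; lra.
move=> x [_ hx]; rewrite /= /R_dist in hx *; apply: (Rle_lt_trans _ _ _ (h x t)).
apply: (Rle_lt_trans _ ((K + 1) * Rabs (x - t))).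
  by apply: Rmult_le_compat_r; [exact: Rabs_pos|lra].
have -> : e = (K + 1) * (e / (K + 1)) by field; lra.
by apply: Rmult_lt_compat_l; lra.
Qed.

Lemma lip1_ex_RInt K g a b : 0 <= K -> lip1 K g -> ex_RInt g a b.
Proof. by move=> K0 h; apply: ex_RInt_continuous => z _; apply: lip1_continuous h. Qed.

Lemma RInt_cell K g a d : 0 <= K -> 0 <= d -> lip1 K g ->
  Rabs (RInt g a (a + d) - d * g a) <= K * d ^ 2.
Proof.
move=> K0 d0 h.
have ex := lip1_ex_RInt a (a + d) K0 h.
have e : RInt g a (a + d) - d * g a = RInt (fun t => g t - g a) a (a + d).
  rewrite (RInt_minus g (fun _ => g a) a (a + d) ex (ex_RInt_const _ _ _)) RInt_const.
  change (RInt g a (a + d) - d * g a = RInt g a (a + d) - (a + d - a) * g a); ring.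
rewrite e (_ : K * d ^ 2 = (a + d - a) * (K * d)); last by ring.
apply: abs_RInt_le_const; first lra.
  by apply: ex_RInt_minus => //; apply: ex_RInt_const.
move=> t [t1 t2]; apply: (Rle_trans _ _ _ (h t a)); apply: Rmult_le_compat_l => //.
by rewrite Rabs_pos_eq; lra.
Qed.

Lemma RInt_sum K g d n : 0 <= K -> 0 <= d -> lip1 K g ->
  Rabs (RInt g 0 (INR n * d) - d * \sum_(i < n) g (d * INR i)) <= INR n * (K * d ^ 2).
Proof.
move=> K0 d0 h; elim: n => [|n IH].
  rewrite big_ord0 /= Rmult_0_l RInt_point /zero /= Rmult_0_r Rminus_0_r Rabs_R0; lra.
have e : INR n.+1 * d = INR n * d + d by rewrite S_INR; ring.
have := RInt_Chasles g 0 (INR n * d) (INR n * d + d)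
  (lip1_ex_RInt _ _ K0 h) (lip1_ex_RInt _ _ K0 h).
rewrite e /plus /= => <-; rewrite big_ord_recr /=.
have := RInt_cell (INR n * d) K0 d0 h; rewrite (Rmult_comm d (INR n)).
set A := RInt _ _ _ in IH *; set B := RInt _ _ _; set C := \big[_/_]_(i < n) _ in IH *.
set D := g _ => hB.
have -> : A + B - d * (C + D) = (A - d * C) + (B - d * D) by ring.
rewrite -/(INR n.+1) S_INR; apply: (Rle_trans _ _ _ (Rabs_triang _ _)); lra.
Qed.

Definition sdist (D : list site) (t u : site -> R) : R := \sum_(k <- D) Rabs (t k - u k).

(** In particular [f] depends only on the angles in [D]. Keeping [D] apart from the list of
    integrated sites lets inductions run over the latter with [D] fixed. *)
Definition lip (D : list site) (K : R) (f : (site -> R) -> R) :=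
  0 <= K /\ forall t u, Rabs (f t - f u) <= K * sdist D t u.

Lemma sdist_update D t u k a : sdist D (update t k a) (update u k a) <= sdist D t u.
Proof.
apply: bsum_le => i _; rewrite /update; case: (site_eqb i k); last lra.
by rewrite Rminus_diag Rabs_R0; apply: Rabs_pos.
Qed.

Lemma sdist_update1 D t k a b : sdist D (update t k a) (update t k b) <= INR (size D) * Rabs (a - b).
Proof.
rewrite /sdist; elim: D => [|x D IH]; first by rewrite big_nil /=; have := Rabs_pos (a - b); lra.
rewrite big_cons [size _]/= S_INR Rmult_plus_distr_r.
suff : Rabs (update t k a x - update t k b x) <= Rabs (a - b) by lra.
by rewrite /update; case: (site_eqb x k); rewrite ?Rminus_diag ?Rabs_R0; [lra|apply: Rabs_pos].
Qed.

Lemma lip_update D K f t k : lip D K f -> lip1 (K * INR (size D)) (fun a => f (update t k a)).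
Proof.
move=> [K0 h] a b; apply: (Rle_trans _ _ _ (h _ _)).
by rewrite Rmult_assoc; apply: Rmult_le_compat_l => //; apply: sdist_update1.
Qed.

Lemma lip_size D K f : lip D K f -> 0 <= K * INR (size D).
Proof. by move=> [K0 _]; apply: Rmult_le_pos => //; apply: pos_INR. Qed.

Lemma PI2_ge0 : 0 <= 2 * PI. Proof. by have := PI_RGT_0; lra. Qed.

Lemma lip_integ D K f sites : lip D K f -> exists K', lip D K' (integ sites f).
Proof.
move=> hf; elim: sites => [|k rest [K' h]]; first by exists K.
exists (2 * PI * K'); split.
  by apply: Rmult_le_pos; [exact: PI2_ge0|by case: h].
move=> t u /=.
have ex t' := lip1_ex_RInt 0 (2 * PI) (lip_size h) (lip_update t' k h).
have := RInt_minus _ _ 0 (2 * PI) (ex t) (ex u); rewrite /minus /plus /opp /= => e.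
rewrite /Rminus -e Rmult_assoc -{2}(Rminus_0_r (2 * PI)).
apply: abs_RInt_le_const; first exact: PI2_ge0.
  exact: (@ex_RInt_minus R_NormedModule _ _ _ _ (ex t) (ex u)).
move=> a _; case: h => K0 h; apply: (Rle_trans _ _ _ (h _ _)).
by apply: Rmult_le_compat_l => //; apply: sdist_update.
Qed.

Fixpoint csum (q : nat) (sites : list site) (f : (site -> R) -> R) (t : site -> R) : R :=
  match sites with
  | nil => f t
  | k :: rest => 2 * PI / INR q * \sum_(i < q) csum q rest f (update t k (2 * PI / INR q * INR i))
  end.

(** The constant is uniform in the remaining angles [t], so the error of the inner sums can be added
    to the Riemann error of the outermost integral. *)
Lemma integ_csum D K f sites : lip D K f ->
  exists C, forall q t, (0 < q)%N -> Rabs (integ sites f t - csum q sites f t) <= C / INR q.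
Proof.
move=> hf; elim: sites => [|k rest [C h]].
  exists 0 => q t q0 /=; rewrite Rminus_diag Rabs_R0; lra.
have [K' h'] := lip_integ rest hf.
exists (K' * INR (size D) * (2 * PI) ^ 2 + 2 * PI * C) => q t q0 /=.
have q1 : 0 < INR q by apply: lt_0_INR; apply/ltP.
set d := 2 * PI / INR q.
have d0 : 0 <= d by apply: Rmult_le_pos; [exact: PI2_ge0|left; apply: Rinv_0_lt_compat].
have e : INR q * d = 2 * PI by rewrite /d; field; lra.
have := RInt_sum q (lip_size h') d0 (lip_update t k h'); rewrite e.
set A := RInt _ _ _; set B := \big[_/_]_(i < q) _ => h1.
have h2 : Rabs (d * B - d * \sum_(i < q) csum q rest f (update t k (d * INR i))) <= 2 * PI * C / INR q.
  rewrite -Rmult_minus_distr_l -bsum_sub Rabs_mult (Rabs_pos_eq d) //.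
  apply: (Rle_trans _ (d * (INR q * (C / INR q)))); last by right; rewrite /d; field; lra.
  apply: Rmult_le_compat_l => //; apply: (Rle_trans _ _ _ (Rabs_bsum _ _ _)).
  apply: (Rle_trans _ (\sum_(i < q) C / INR q)); first by apply: bsum_le => i _; apply: h.
  by rewrite bsum_const card_ord; lra.
set E := \big[_/_]_(i < q) _ in h2 *.
have -> : A - d * E = (A - d * B) + (d * B - d * E) by ring.
apply: (Rle_trans _ _ _ (Rabs_triang _ _)).
have -> : (K' * INR (size D) * (2 * PI) ^ 2 + 2 * PI * C) / INR q =
  INR q * (K' * INR (size D) * d ^ 2) + 2 * PI * C / INR q by rewrite /d; field; lra.
lra.
Qed.

Lemma csum_lim D K f sites t : lip D K f ->
  is_lim_seq (fun q => csum q.+1 sites f t) (integ sites f t).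
Proof.
move=> hf; have [C h] := integ_csum sites hf.
have l0 : is_lim_seq (fun q => / INR q.+1) 0.
  apply/(is_lim_seq_incr_1 (fun n => / INR n)).
  exact: (is_lim_seq_inv _ p_infty is_lim_seq_INR).
have lC : is_lim_seq (fun q => C * / INR q.+1) 0.
  by have := is_lim_seq_scal_l _ C _ l0; rewrite /= Rmult_0_r.
have l1 : is_lim_seq (fun q => csum q.+1 sites f t - integ sites f t) 0.
  apply/is_lim_seq_abs_0; apply: is_lim_seq_le_le (is_lim_seq_const 0) lC => q.
  by split; [exact: Rabs_pos|rewrite Rabs_minus_sym; apply: h].
have := is_lim_seq_plus' _ _ _ _ l1 (is_lim_seq_const (integ sites f t)).
rewrite Rplus_0_l; apply: is_lim_seq_ext => q; ring.
Qed.

(** * Bounded Lipschitz observables *)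

(** The bound is carried along because products and exponentials of Lipschitz functions call for
    it. *)
Definition blip (D : list site) (f : (site -> R) -> R) :=
  exists K C, [/\ lip D K f, 0 <= C & forall t, Rabs (f t) <= C].

Lemma sdist_ge0 D t u : 0 <= sdist D t u.
Proof. by apply: bsum_ge0 => k _; apply: Rabs_pos. Qed.

Lemma blip_const D c : blip D (fun _ => c).
Proof.
exists 0, (Rabs c); split=> [||t]; [split; [lra|]|exact: Rabs_pos|lra].
by move=> t u; rewrite Rminus_diag Rabs_R0; lra.
Qed.

Lemma blip_add D f g : blip D f -> blip D g -> blip D (fun t => f t + g t).
Proof.
move=> [K [C [[K0 hf] C0 bf]]] [K' [C' [[K0' hg] C0' bg]]].
exists (K + K'), (C + C'); split=> [||t]; last 2 [lra].
- split; first lra.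
  move=> t u; have -> : f t + g t - (f u + g u) = (f t - f u) + (g t - g u) by ring.
  apply: (Rle_trans _ _ _ (Rabs_triang _ _)); rewrite Rmult_plus_distr_r.
  exact: Rplus_le_compat.
- apply: (Rle_trans _ _ _ (Rabs_triang _ _)); exact: Rplus_le_compat.
Qed.

Lemma blip_mul D f g : blip D f -> blip D g -> blip D (fun t => f t * g t).
Proof.
move=> [K [C [[K0 hf] C0 bf]]] [K' [C' [[K0' hg] C0' bg]]].
exists (K * C' + C * K'), (C * C'); split=> [||t]; last first.
- by rewrite Rabs_mult; apply: Rmult_le_compat => //; apply: Rabs_pos.
- exact: Rmult_le_pos.
split; first by apply: Rplus_le_le_0_compat; apply: Rmult_le_pos.
move=> t u; have -> : f t * g t - f u * g u = (f t - f u) * g t + f u * (g t - g u) by ring.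
apply: (Rle_trans _ _ _ (Rabs_triang _ _)); rewrite !Rabs_mult.
have -> : (K * C' + C * K') * sdist D t u = K * sdist D t u * C' + C * (K' * sdist D t u) by ring.
by apply: Rplus_le_compat; apply: Rmult_le_compat => //; apply: Rabs_pos.
Qed.

Lemma blip_sum D (A : Type) (l : list A) (F : A -> (site -> R) -> R) :
  (forall a, blip D (F a)) -> blip D (fun t => sumR l (fun a => F a t)).
Proof.
by move=> h; elim: l => [|a l IH] /=; [exact: blip_const|apply: blip_add].
Qed.

Lemma blip_comp D (phi : R -> R) k : List.In k D -> lip1 1 phi -> (forall x, Rabs (phi x) <= 1) ->
  blip D (fun t => phi (t k)).
Proof.
move=> kD hp bp; exists 1, 1; split=> [||t]; [split; [lra|]|lra|exact: bp].
move=> t u; apply: (Rle_trans _ _ _ (hp _ _)); rewrite !Rmult_1_l /sdist.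
elim: D kD => //= x D IH; rewrite big_cons; case=> [->|/IH h].
  by have := sdist_ge0 D t u; rewrite /sdist; lra.
by have := Rabs_pos (t x - u x); lra.
Qed.

Lemma lip1_deriv phi dphi : (forall x, is_derive phi x (dphi x)) -> (forall x, Rabs (dphi x) <= 1) ->
  lip1 1 phi.
Proof.
move=> hd hb s t; apply: (@bounded_variation _ dphi) => x _.
by split; [exact: hd|exact: hb].
Qed.

Lemma Rabs_cos x : Rabs (cos x) <= 1.
Proof. by apply: Rabs_le; apply: COS_bound. Qed.

Lemma Rabs_sin x : Rabs (sin x) <= 1.
Proof. by apply: Rabs_le; apply: SIN_bound. Qed.

Lemma blip_cos D k : List.In k D -> blip D (fun t => cos (t k)).
Proof.
move=> kD; apply: blip_comp => //; last exact: Rabs_cos.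
apply: (@lip1_deriv _ (fun x => - sin x)) => x; last by rewrite Rabs_Ropp; apply: Rabs_sin.
by auto_derive => //; ring.
Qed.

Lemma blip_sin D k : List.In k D -> blip D (fun t => sin (t k)).
Proof.
move=> kD; apply: blip_comp => //; last exact: Rabs_sin.
apply: (@lip1_deriv _ cos) => x; last exact: Rabs_cos.
by auto_derive => //; ring.
Qed.

Lemma exp_lip C a b : a <= C -> b <= C -> Rabs (exp a - exp b) <= exp C * Rabs (a - b).
Proof.
wlog ab : a b / b <= a => [h ha hb|ha hb].
  case: (Rle_dec b a) => hab; first exact: h.
  by rewrite Rabs_minus_sym (Rabs_minus_sym a); apply: h => //; lra.
have le : exp b <= exp a by case: ab => [?|->]; [left; apply: exp_increasing|right].
have lC : exp a <= exp C by case: ha => [?|->]; [left; apply: exp_increasing|right].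
rewrite !Rabs_pos_eq; try lra.
have -> : exp a - exp b = exp a * (1 - exp (b - a)).
  by rewrite Rmult_minus_distr_l Rmult_1_r -exp_plus; congr (_ - exp _); ring.
have := exp_ineq1_le (b - a) => h.
apply: (Rle_trans _ (exp a * (a - b))); first by apply: Rmult_le_compat_l; [exact: exp_ge0|lra].
by apply: Rmult_le_compat_r; lra.
Qed.

Lemma blip_exp D f : blip D f -> blip D (fun t => exp (f t)).
Proof.
move=> [K [C [[K0 hf] C0 bf]]].
have le t : f t <= C by have := Rle_abs (f t); have := bf t; lra.
exists (exp C * K), (exp C); split=> [||t]; last first.
- rewrite Rabs_pos_eq; last exact: exp_ge0.
  by case: (le t) => [?|->]; [left; apply: exp_increasing|right].
- exact: exp_ge0.
split; first by apply: Rmult_le_pos => //; apply: exp_ge0.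
move=> t u; apply: (Rle_trans _ _ _ (exp_lip (le t) (le u))); rewrite Rmult_assoc.
by apply: Rmult_le_compat_l => //; apply: exp_ge0.
Qed.

Delimit Scope Z_scope with ZZ.

(** * Boxes and the clock approximation of finite volume Gibbs states *)

Lemma in_Zrange n a : List.In a (Zrange n) <-> (- Z.of_nat n <= a <= Z.of_nat n)%ZZ.
Proof.
rewrite /Zrange in_map_iff; split=> [[i [<- /in_seq]]|h]; first by lia.
by exists (Z.to_nat (a + Z.of_nat n)); rewrite in_seq; lia.
Qed.

Lemma in_box n a b c : List.In (a, b, c) (box n) <->
  (Z.abs a <= Z.of_nat n)%ZZ /\ (Z.abs b <= Z.of_nat n)%ZZ /\ (Z.abs c <= Z.of_nat n)%ZZ.
Proof.
rewrite /box in_flat_map; split.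
  move=> [x [/in_Zrange hx /in_flat_map[y [/in_Zrange hy /in_map_iff[z [[<- <- <-] /in_Zrange hz]]]]]].
  lia.
move=> h; exists a; split; first by apply/in_Zrange; lia.
apply/in_flat_map; exists b; split; first by apply/in_Zrange; lia.
by apply/in_map_iff; exists c; split=> //; apply/in_Zrange; lia.
Qed.

Lemma in_interiorE n z : List.In z (box n) <-> in_interior n.+1 z.
Proof.
case: z => [[a b] c]; rewrite in_box /in_interior; split.
  by move=> h; apply/andP; split; [apply/andP; split|]; apply/Z.ltb_lt; lia.
by case/andP => /andP[/Z.ltb_lt ha /Z.ltb_lt hb] /Z.ltb_lt hc; lia.
Qed.

Lemma in_interior_le n k z : (n <= k)%N -> in_interior n z -> in_interior k z.
Proof.
case: z => [[a b] c] nk; rewrite /in_interior.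
case/andP => /andP[/Z.ltb_lt ha /Z.ltb_lt hb] /Z.ltb_lt hc.
by apply/andP; split; [apply/andP; split|]; apply/Z.ltb_lt; lia.
Qed.

Lemma NoDup_flat_map (A B : Type) (f : A -> list B) l :
  (forall a, NoDup (f a)) -> (forall a b x, List.In x (f a) -> List.In x (f b) -> a = b) ->
  NoDup l -> NoDup (flat_map f l).
Proof.
move=> hf hd; elim: l => [|a l IH] h /=; first exact: NoDup_nil.
inversion h; subst; apply: NoDup_app => [//||x hx /in_flat_map[b [hb hxb]]]; first exact: IH.
by have e := hd _ _ _ hx hxb; subst.
Qed.

Lemma NoDup_map_inj (A B : Type) (f : A -> B) l :
  (forall x y, f x = f y -> x = y) -> NoDup l -> NoDup (List.map f l).
Proof.
move=> inj; elim=> [|x r nx _ IH] /=; first exact: NoDup_nil.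
by apply: NoDup_cons => // /in_map_iff[y [/inj ->]].
Qed.

Lemma NoDup_Zrange n : NoDup (Zrange n).
Proof. by apply: NoDup_map_inj; [move=> i j; lia|apply: seq_NoDup]. Qed.

Lemma NoDup_box n : NoDup (box n).
Proof.
apply: NoDup_flat_map (NoDup_Zrange n) => [a|a b x].
  apply: NoDup_flat_map (NoDup_Zrange n) => [b|b c x].
    by apply: NoDup_map_inj (NoDup_Zrange n) => c d [].
  by move=> /in_map_iff[y [<- _]] /in_map_iff[z [[->]]].
by move=> /in_flat_map[y [_ /in_map_iff[z [<- _]]]] /in_flat_map[u [_ /in_map_iff[v [[->]]]]].
Qed.

Lemma site_eqP z w : reflect (z = w) (site_eqb z w).
Proof.
case: z w => [[a b] c] [[a' b'] c']; apply: (iffP idP).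
  by case/andP => /andP[/Z.eqb_eq -> /Z.eqb_eq ->] /Z.eqb_eq ->.
by case=> -> -> ->; rewrite /site_eqb !Z.eqb_refl.
Qed.

Lemma sumRE (A : Type) (l : list A) f : sumR l f = \sum_(a <- l) f a.
Proof. by elim: l => [|a l IH]; rewrite ?big_nil ?big_cons //= IH. Qed.

Section Observables.
Variables (L : nat) (nu : bc) (beta : R).

Lemma interior_In k : in_interior L k -> List.In k (box L).
Proof. by move=> h; apply/in_interiorE; apply: in_interior_le h. Qed.

Lemma blip_hamiltonian : blip (box L) (fun t => - beta * hamiltonian L nu t).
Proof.
apply: blip_mul; first exact: blip_const.
suff h : blip (box L) (fun t => -1 * sumR (box L) (fun k => sumR (box L) (fun l =>
        J k l * dot (spin L nu t k) (spin L nu t l)))).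
  have e : hamiltonian L nu = (fun t => -1 * sumR (box L) (fun k => sumR (box L) (fun l =>
        J k l * dot (spin L nu t k) (spin L nu t l)))).
    by apply: functional_extensionality => t; rewrite /hamiltonian; ring.
  by rewrite e.
apply: blip_mul; first exact: blip_const.
apply: blip_sum => k; apply: blip_sum => l; apply: blip_mul; first exact: blip_const.
have c x : blip (box L) (fun t => fst (spin L nu t x)).
  rewrite /spin; case h : (in_interior L x); first by apply: blip_cos; apply: interior_In.
  by case: nu; apply: blip_const.
have s x : blip (box L) (fun t => snd (spin L nu t x)).
  rewrite /spin; case h : (in_interior L x); first by apply: blip_sin; apply: interior_In.
  by case: nu; apply: blip_const.
by rewrite /dot; apply: blip_add; apply: blip_mul.
Qed.

Lemma blip_gibbs F : blip (box L) F ->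
  exists K, lip (box L) K (fun t => exp (- beta * hamiltonian L nu t) * F t).
Proof.
by move=> hF; have [K [C [h _ _]]] := blip_mul (blip_exp blip_hamiltonian) hF; exists K.
Qed.

Lemma blip_spin_corr x y : List.In x (box L) -> List.In y (box L) -> blip (box L) (spin_corr x y).
Proof.
by move=> hx hy; apply: blip_add; apply: blip_mul; (apply: blip_cos || apply: blip_sin).
Qed.

Definition cgibbs (q : nat) (F : (site -> R) -> R) : R :=
  csum q (box (L - 1)) (fun t => exp (- beta * hamiltonian L nu t) * F t) (fun _ => 0).

Lemma cgibbs_lim F : blip (box L) F -> is_lim_seq (fun q => cgibbs q.+1 F) (gibbs beta nu L F).
Proof. by move=> /blip_gibbs[K hK]; apply: csum_lim hK. Qed.

Lemma csum_ge q sites f t c : (0 < q)%N -> (forall u, c <= f u) -> (2 * PI) ^ (size sites) * c <= csum q sites f t.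
Proof.
move=> q0 h; elim: sites t => [|k s IH] t; first by rewrite /= Rmult_1_l.
have q1 : 0 < INR q by apply: lt_0_INR; apply/ltP.
have d0 : 0 <= 2 * PI / INR q.
  by apply: Rmult_le_pos; [exact: PI2_ge0|left; apply: Rinv_0_lt_compat].
rewrite [size _]/= [csum _ _ _ _]/=.
apply: (Rle_trans _ (2 * PI / INR q * \sum_(i < q) (2 * PI) ^ (size s) * c)).
  by rewrite bsum_const card_ord /=; right; field; lra.
by apply: Rmult_le_compat_l => //; apply: bsum_le => i _; apply: IH.
Qed.

(** The Boltzmann factor is at least [exp (- C)], so all clock sums share a positive lower bound,
    which survives the limit. *)
Lemma gibbs_one_gt0 : 0 < gibbs beta nu L (fun _ => 1).
Proof.
have [K [C [_ C0 bH]]] := blip_hamiltonian.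
have l := cgibbs_lim (blip_const (box L) 1).
apply: (Rlt_le_trans _ ((2 * PI) ^ (size (box (L - 1))) * exp (- C))).
  by apply: Rmult_lt_0_compat; [apply: pow_lt; have := PI_RGT_0; lra|apply: exp_pos].
have := is_lim_seq_le _ _ _ _ _ (is_lim_seq_const ((2 * PI) ^ (size (box (L - 1))) * exp (- C))) l.
apply=> q.
apply: csum_ge => // u; rewrite Rmult_1_r.
have := bH u; move/Rabs_le_between => [h _].
by case: h => [h|->]; [left; apply: exp_increasing|right].
Qed.

Lemma cgibbs_ratio_lim F : blip (box L) F ->
  is_lim_seq (fun q => cgibbs q.+1 F / cgibbs q.+1 (fun _ => 1)) (gibbs beta nu L F / partition beta nu L).
Proof.
move=> hF; apply: is_lim_seq_div'; [exact: cgibbs_lim|exact: cgibbs_lim (blip_const _ _)|].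
by have := gibbs_one_gt0; rewrite /partition; lra.
Qed.

End Observables.

(** * Clock sums as sums over torus configurations *)

Section ConfigSum.
Variables (q : nat) (V : finType) (em : site -> V).
Local Notation N := q.+2.
Local Notation X := {ffun V -> 'I_N}.

(** Exchanging the fresh value with the one it overwrites is a bijection. *)
Lemma resample (G : X -> R) (v : V) :
  \sum_(i : 'I_N) \sum_(s : X) G [ffun x => if x == v then i else s x] = INR N * \sum_(s : X) G s.
Proof.
have -> : INR N * \sum_(s : X) G s = \sum_(i : 'I_N) \sum_(s : X) G s.
  by rewrite bsum_const card_ord.
rewrite !pair_big /= [RHS](reindex_inj (h := fun u : 'I_N * X =>
  (u.2 v, [ffun x => if x == v then u.1 else u.2 x]))) //=.
move=> [i s] [i' s'] /= [e1 e2].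
have h x := congr1 (fun t : X => t x) e2.
have := h v; rewrite !ffunE eqxx => ->; congr pair; apply/ffunP => x.
by have := h x; rewrite !ffunE; case: eqP => // ->.
Qed.

Definition over (sites : list site) (s : X) (t : site -> R) (z : site) : R :=
  if has (site_eqb z) sites then ang (s (em z)) else t z.

Lemma has_In z l : reflect (List.In z l) (has (site_eqb z) l).
Proof.
elim: l => [|x l IH] /=; first by constructor.
by apply: (iffP orP) => [[/site_eqP->|/IH]|[->|/IH]]; auto; left; apply/site_eqP.
Qed.

Lemma csum_cons n k r f t : csum n (k :: r) f t =
  2 * PI / INR n * \sum_(i < n) csum n r f (update t k (2 * PI / INR n * INR i)).
Proof. by []. Qed.

(** Spins at torus points outside the image of [sites] are averaged out, so iterated sums over a box
    become one sum over a torus of any size, normalised by [#|X|]. *)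
Lemma csum_config sites f t : NoDup sites ->
  (forall x y, List.In x sites -> List.In y sites -> em x = em y -> x = y) ->
  csum N sites f t = (2 * PI) ^ (size sites) / INR #|X| * \sum_(s : X) f (over sites s t).
Proof.
have X0 : INR #|X| <> 0 by apply: not_0_INR; apply/eqP; rewrite -lt0n; apply/card_gt0P; exists [ffun=> ord0].
elim: sites t => [|k r IH] t.
  move=> _ _ /=; have -> : \sum_(s : X) f (over nil s t) = INR #|X| * f t.
    by transitivity (\sum_(s : X) f t) => //; rewrite bsum_const.
  by field.
move=> nd inj; rewrite csum_cons.
have nk : ~ List.In k r by inversion nd.
have nr : NoDup r by inversion nd.
have injr x y : List.In x r -> List.In y r -> em x = em y -> x = y.
  by move=> hx hy; apply: inj; right.
have e (i : 'I_N) : csum N r f (update t k (2 * PI / INR N * INR i)) = (2 * PI) ^ (size r) / INR #|X| *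
   \sum_(s : X) f (over (k :: r) [ffun x => if x == em k then i else s x] t).
  rewrite IH //; congr (_ * _); apply: eq_bigr => s _; congr f.
  apply: functional_extensionality => z; rewrite /over /= /update ffunE.
  case: has_In => [hz|hz].
    case: (site_eqP z k) => [zk|zk]; first by subst.
    by rewrite orbT; case: eqP => // /inj h; case: zk; apply: h; [right|left].
  by rewrite orbF; case: (site_eqP z k) => [->|//]; rewrite eqxx.
under eq_bigr => i _ do rewrite e.
rewrite -bsum_mulr (resample (fun s => f (over (k :: r) s t))).
change (size (k :: r)) with (size r).+1.
cbv beta; set S := \sum_s _; have N0 : INR N <> 0 by apply: not_0_INR.
rewrite -tech_pow_Rmult. by field.
Qed.

Definition lift (L : nat) (s : X) (z : site) : R := if in_interior L z then ang (s (em z)) else 0.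

Lemma cgibbs_config L nu beta F :
  (forall x y, in_interior L.+1 x -> in_interior L.+1 y -> em x = em y -> x = y) ->
  cgibbs L.+1 nu beta N F = (2 * PI) ^ (size (box L)) / INR #|X| *
   \sum_(s : X) exp (- beta * hamiltonian L.+1 nu (lift L.+1 s)) * F (lift L.+1 s).
Proof.
move=> inj; rewrite /cgibbs subn1 /= csum_config; first last.
- by move=> x y /in_interiorE hx /in_interiorE hy; apply: inj.
- exact: NoDup_box.
congr (_ * _); apply: eq_bigr => s _.
have -> // : over (box L) s (fun _ => 0) = lift L.+1 s.
apply: functional_extensionality => z; rewrite /over /lift.
by case: has_In => [/in_interiorE ->|h] //; case: ifP => // /in_interiorE.
Qed.

End ConfigSum.

(** * Embedding lattice boxes in the torus *)

Section Embed.
Variable m : nat.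
Local Notation N := m.+2.
Local Notation V := {ffun 'I_3 -> 'I_N}.
Local Notation n := (Z.of_nat N).

Definition zr (z : Z) : 'I_N := inZp (Z.to_nat (Z.modulo z n)).

Lemma zr_spec z : exists t, z = (Z.of_nat (zr z) + t * n)%ZZ.
Proof.
exists (Z.div z n).
have h := Z.div_mod z n ltac:(lia); have [h1 h2] := Z.mod_pos_bound z n ltac:(lia).
have -> : nat_of_ord (zr z) = Z.to_nat (Z.modulo z n) by rewrite /= modn_small //; lia.
by rewrite Z2Nat.id; lia.
Qed.

Lemma zr_uniq z (x : 'I_N) t : z = (Z.of_nat x + t * n)%ZZ -> zr z = x.
Proof.
move=> e; have [u eu] := zr_spec z; apply: val_inj.
change (nat_of_ord (zr z) = nat_of_ord x).
move: (ltn_ord x) (ltn_ord (zr z)) eu e; move: (nat_of_ord (zr z)) (nat_of_ord x) => a b hb ha e1 e2.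
have : (t = u)%ZZ by nia.
by move=> tu; subst t; lia.
Qed.

Lemma zrD a b : zr (a + b)%ZZ = (zr a + zr b)%R.
Proof.
have [t ea] := zr_spec a; have [u eb] := zr_spec b.
apply: (@zr_uniq _ _ (t + u + Z.of_nat ((zr a + zr b) %/ N)%N)).
have := divn_eq (zr a + zr b) N; rewrite -[((zr a + zr b) %% N)%N]/(nat_of_ord (zr a + zr b)%R).
move: (nat_of_ord (zr a + zr b)%R) ((zr a + zr b) %/ N)%N => x k e.
nia.
Qed.

Lemma zr_nat k : zr (Z.of_nat k) = inZp k.
Proof.
by apply: (@zr_uniq _ _ (Z.of_nat (k %/ N)%N)); rewrite /=; have := divn_eq k N; nia.
Qed.

Lemma zr1 : zr 1 = 1%R.
Proof. exact: (zr_nat 1). Qed.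

Lemma zr_inj a b : zr a = zr b -> (Z.abs (a - b) < n)%ZZ -> a = b.
Proof.
have [t ea] := zr_spec a; have [u eb] := zr_spec b => e h.
rewrite e in ea; have tu : (t = u)%ZZ by nia.
by subst t; lia.
Qed.

(** The balanced representative, so that boxes of radius below half the side of the torus are
    recovered from their images. *)
Definition dz (x : 'I_N) : Z :=
  if (2 * Z.of_nat x <? n)%ZZ then Z.of_nat x else (Z.of_nat x - n)%ZZ.

Lemma zr_dz x : zr (dz x) = x.
Proof.
rewrite /dz; case: ifP => _; first by apply: (@zr_uniq _ _ 0); lia.
by apply: (@zr_uniq _ _ (-1)); lia.
Qed.

Lemma dz_zr z : (2 * Z.abs z < n)%ZZ -> dz (zr z) = z.
Proof.
move=> h; apply: zr_inj; rewrite ?zr_dz // /dz; have := ltn_ord (zr z).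
by case: Z.ltb_spec; lia.
Qed.

Definition coord (z : site) (l : 'I_3) : Z :=
  match z with (a, b, c) => match nat_of_ord l with 0%N => a | 1%N => b | _ => c end end.

Variable o : V.

Definition em (z : site) : V := [ffun l => o l + zr (coord z l)]%R.

Definition dec (v : V) : site :=
  (dz (v (inord 0) - o (inord 0))%R, dz (v (inord 1) - o (inord 1))%R, dz (v (inord 2) - o (inord 2))%R).

Lemma em_dec v : em (dec v) = v.
Proof.
apply/ffunP => l; rewrite ffunE /dec /coord.
case: (ord3P l) => ->; rewrite inordK // zr_dz GRing.addrC GRing.subrK //.
Qed.

Lemma dec_em R0 z : (2 * R0 <= N)%N -> in_interior R0 z -> dec (em z) = z.
Proof.
case: z => [[a b] c] hR; rewrite /in_interior.
case/andP => /andP[/Z.ltb_lt ha /Z.ltb_lt hb] /Z.ltb_lt hc.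
rewrite /dec !ffunE /coord !inordK // !(GRing.addrC (o _)) !GRing.addrK.
by rewrite !dz_zr //; lia.
Qed.

Lemma em_inj R0 x y : (2 * R0 <= N)%N -> in_interior R0 x -> in_interior R0 y -> em x = em y -> x = y.
Proof. by move=> hR hx hy e; rewrite -(dec_em hR hx) -(dec_em hR hy) e. Qed.

Definition nudge (z : site) (k : 'I_3) (s : Z) : site :=
  match z with (a, b, c) =>
    match nat_of_ord k with 0%N => (a + s, b, c)%ZZ | 1%N => (a, b + s, c)%ZZ | _ => (a, b, c + s)%ZZ end
  end.

Lemma em_nudge z k : em (nudge z k 1) = (em z + unitv m k)%R.
Proof.
case: z => [[a b] c]; apply/ffunP => l; rewrite !ffunE -GRing.addrA; congr (_ + _)%R.
case: (ord3P l) => ->; case: (ord3P k) => ->;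
  rewrite (inordE _ (inordK _)) // /nudge /coord !inordK //= ?GRing.addr0 ?zrD ?zr1 //.
Qed.

Lemma nudgeK z k s : nudge (nudge z k s) k (- s) = z.
Proof.
case: z => [[a b] c]; rewrite /nudge; case: (nat_of_ord k) => [|[|?]];
  congr (_, _, _); lia.
Qed.

Lemma nudge_interior R0 z k s : (Z.abs s <= 1)%ZZ -> in_interior R0 z -> in_interior R0.+1 (nudge z k s).
Proof.
case: z => [[a b] c] hs; rewrite /in_interior /nudge.
case/andP => /andP[/Z.ltb_lt ha /Z.ltb_lt hb] /Z.ltb_lt hc.
by case: (nat_of_ord k) => [|[|?]]; (apply/andP; split; [apply/andP; split|]); apply/Z.ltb_lt; lia.
Qed.

Lemma J_nudge z k s : (Z.abs s = 1)%ZZ -> J z (nudge z k s) = 1 / 6.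
Proof.
case: z => [[a b] c] hs; rewrite /nudge; case: (nat_of_ord k) => [|[|?]]; rewrite /J;
  case: Z.eqb_spec => //; lia.
Qed.

Lemma J_neq0 z w : J z w <> 0 -> exists k s, (s = 1 \/ s = -1)%ZZ /\ w = nudge z k s.
Proof.
case: z w => [[a b] c] [[a' b'] c']; rewrite /J; case: Z.eqb_spec => // h _.
case: (Z.eq_dec a a') => ha; last first.
  by exists (inord 0), (a' - a)%ZZ; rewrite /nudge inordK //; split; [lia|congr (_, _, _); lia].
case: (Z.eq_dec b b') => hb; last first.
  by exists (inord 1), (b' - b)%ZZ; rewrite /nudge inordK //; split; [lia|congr (_, _, _); lia].
by exists (inord 2), (c' - c)%ZZ; rewrite /nudge inordK //; split; [lia|congr (_, _, _); lia].
Qed.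

Lemma J_bool z w : J z w = 0 \/ J z w = 1 / 6.
Proof. by case: z w => [[a b] c] [[a' b'] c']; rewrite /J; case: Z.eqb_spec; auto. Qed.

Lemma JC z w : J z w = J w z.
Proof.
case: z w => [[a b] c] [[a' b'] c']; rewrite /J.
by rewrite -(Z.abs_opp (a - a')) -(Z.abs_opp (b - b')) -(Z.abs_opp (c - c')) !Z.opp_sub_distr
  !(Z.add_comm (- _)).
Qed.

(** The margin of one site in [2 * R0.+1 <= N] prevents edges at interior points from wrapping
    around the torus. *)
Lemma tadj_dec R0 x y : (2 * R0.+1 <= N)%N -> in_interior R0 (dec x) -> tadj x y ->
  exists k s, (s = 1 \/ s = -1)%ZZ /\ dec y = nudge (dec x) k s.
Proof.
move=> hR hx /existsP[k /orP[] /eqP e]; exists k.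
  exists 1%ZZ; split; first by left.
  rewrite e -{1}(em_dec x) -em_nudge (dec_em hR) //; exact: nudge_interior.
exists (-1)%ZZ; split; first by right.
rewrite -(dec_em hR (@nudge_interior _ _ k (-1)%ZZ _ hx)) //; congr dec.
apply: (@GRing.addIr _ (unitv m k)); rewrite -e -em_nudge -{1}(em_dec x); congr em.
by rewrite (nudgeK _ k (-1)).
Qed.

Lemma J_dec R0 x y : (2 * R0.+1 <= N)%N -> in_interior R0 (dec x) ->
  J (dec x) (dec y) = b2R (tadj x y) / 6.
Proof.
move=> hR hx; case a : (tadj x y).
  have [k [s [hs ->]]] := tadj_dec hR hx a; rewrite J_nudge //; lia.
case: (J_bool (dec x) (dec y)) => [->|h]; first by rewrite /=; lra.
exfalso; have [k [s [hs e]]] := @J_neq0 (dec x) (dec y) ltac:(lra).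
suff : tadj x y by rewrite a.
apply/existsP; exists k; case: hs => es; subst s.
  by rewrite -{1}(em_dec y) e em_nudge em_dec eqxx.
apply/orP; right; apply/eqP.
have ed : nudge (dec y) k 1 = dec x by rewrite e (nudgeK _ k (-1)).
by rewrite -{1}(em_dec x) -ed em_nudge em_dec.
Qed.

Lemma sum_box L (phi : site -> R) : (2 * L.+1 <= N)%N ->
  \sum_(k <- box L) phi k = \sum_(v : V) b2R (in_interior L.+1 (dec v)) * phi (dec v).
Proof.
move=> hL.
have one (l : list site) z (c : R) : NoDup l ->
    \sum_(k <- l) b2R (site_eqb k z) * c = b2R (has (site_eqb z) l) * c.
  elim: l => [|x l IH] nd; first by rewrite big_nil /=; ring.
  have nx : ~ List.In x l by inversion nd.
  rewrite big_cons IH; last by inversion nd.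
  rewrite /= (_ : site_eqb z x = site_eqb x z); last by apply/site_eqP/site_eqP.
  case: site_eqP => [e|_] /=; last by ring.
  by subst; case: has_In => //= _; ring.
have -> : \sum_(k <- box L) phi k = \sum_(k <- box L) \sum_(v : V) b2R (v == em k) * phi k.
  by apply: eq_bigr => k _; rewrite (bsum_delta _ (fun _ => phi k)).
rewrite exchange_big /=; apply: eq_bigr => v _.
have -> : b2R (in_interior L.+1 (dec v)) = b2R (has (site_eqb (dec v)) (box L)).
  by congr b2R; apply/idP/has_In => [h|h]; apply/in_interiorE.
rewrite -one; last exact: NoDup_box.
have : forall k, List.In k (box L) -> b2R (v == em k) * phi k = b2R (site_eqb k (dec v)) * phi (dec v).
  move=> k /in_interiorE hk; case: eqP => [->|ne] /=.
    by rewrite (dec_em hL hk); case: site_eqP.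
  case: site_eqP => [e|_] /=; last by ring.
  by case: ne; rewrite e em_dec.
elim: (box L) => [|x l IH] h; first by rewrite !big_nil.
by rewrite !big_cons (h x) ?IH //; [move=> k hk; apply: h; right|left].
Qed.

End Embed.

(** * Comparison of free, periodic and plus boundary conditions *)

Section Compare.
Variables (q m : nat) (beta : R).
Hypothesis oddq : odd q.
Hypothesis evenm : ~~ odd m.
Hypothesis beta0 : 0 < beta.
Local Notation NT := m.+2.
Local Notation V := {ffun 'I_3 -> 'I_NT}.
Local Notation X := {ffun V -> 'I_q.+2}.

Definition diff (i : V * V) (s : X) : 'I_q.+2 := (s i.1 - s i.2)%R.

Lemma diffD i a b : diff i (a + b)%R = (diff i a + diff i b)%R.
Proof. by rewrite /diff !ffunE GRing.opprD GRing.addrACA. Qed.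

Lemma diffB i a b : diff i (a - b)%R = (diff i a - diff i b)%R.
Proof. by rewrite /diff !ffunE !GRing.opprD GRing.addrACA. Qed.

Definition wt (c : V * V -> R) (s : X) : R := exp (\sum_i c i * cosq (diff i s)).
Definition wZ (c : V * V -> R) : R := \sum_(s : X) wt c s.
Definition wC (c : V * V -> R) (x y : V) : R := \sum_(s : X) wt c s * cosq (diff (x, y) s).

Lemma wZ_gt0 c : 0 < wZ c.
Proof.
rewrite /wZ (bigD1 [ffun=> ord0]) //=; apply: Rplus_lt_le_0_compat; first exact: exp_pos.
by apply: bsum_ge0 => s _; apply: exp_ge0.
Qed.

Lemma wC_mono c d x y : (forall i, 0 <= c i <= d i) -> wC c x y / wZ c <= wC d x y / wZ d.
Proof.
move=> h; have c0 := wZ_gt0 c; have d0 := wZ_gt0 d.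
have := ginibre oddq pred0 h diffD diffB (diffD (x, y)) (diffB (x, y)) => /=.
have m0 (s : X) : mask pred0 s == 0%R by apply/eqP/ffunP => v; rewrite !ffunE.
under [\sum_s b2R _ * exp _]eq_bigr => s _ do rewrite m0 /= Rmult_1_l.
under [\sum_s b2R _ * (exp _ * _)]eq_bigr => s _ do rewrite m0 /= Rmult_1_l.
rewrite -/(wZ d) -/(wZ c) -/(wC c x y) -/(wC d x y) => g.
apply: (Rmult_le_reg_r (wZ c * wZ d)); first exact: Rmult_lt_0_compat.
have -> : wC c x y / wZ c * (wZ c * wZ d) = wC c x y * wZ d by field; lra.
by have -> : wC d x y / wZ d * (wZ c * wZ d) = wZ c * wC d x y by field; lra.
Qed.

Definition ctorus (i : V * V) : R := beta / 6 * b2R (tadj i.1 i.2).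

Lemma W_torus (s : X) : W (@cosq q) (@sinq q) (@tadj m) (beta / 6) s = wt ctorus s.
Proof.
rewrite /W /wt; congr exp; rewrite pair_big_dep bsum_mulr /= big_mkcond /=.
apply: eq_bigr => -[x y] _; rewrite /ctorus /diff /= cosqB.
by case: (tadj x y) => /=; ring.
Qed.

Lemma corr_torus x y : corr (beta / 6) (@cosq q) (@sinq q) x y = wC ctorus x y.
Proof.
by apply: eq_bigr => s _; rewrite W_torus /diff /= cosqB.
Qed.

Section Freeze.
Variable P : pred V.

Definition splice (a b : X) : X := [ffun v => if P v then a v else b v].

Lemma sum_splice (f : X -> X -> R) :
  \sum_(a : X) \sum_(b : X) f (splice a b) (splice b a) = \sum_(a : X) \sum_(b : X) f a b.
Proof.
rewrite !pair_big /= [RHS](reindex_inj (h := fun u : X * X => (splice u.1 u.2, splice u.2 u.1))) //=.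
move=> [a b] [c d] /= [e1 e2]; congr pair; apply/ffunP => v;
  have := congr1 (fun s : X => s v) e1; have := congr1 (fun s : X => s v) e2;
  by rewrite !ffunE; case: (P v).
Qed.

(** Exchanging the values of two configurations outside [P] shows that erasing the spins there and
    conditioning them to vanish differ by a constant, which cancels in ratios. *)
Lemma sum_mask : exists2 k, 0 < k & forall G : X -> R,
  \sum_(s : X) G (mask P s) = k * \sum_(s : X) b2R (mask (fun v => ~~ P v) s == 0%R) * G s.
Proof.
pose Q (s : X) := mask (fun v => ~~ P v) s == 0%R.
pose k0 := \sum_(t : X) b2R (Q t).
have k0p : 0 < k0.
  rewrite /k0 (bigD1 (0%R : X)) //= (_ : Q (0%R : X)); last first.
    by apply/eqP/ffunP => v; rewrite !ffunE; case: ifP.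
  apply: Rplus_lt_le_0_compat => /=; first lra.
  by apply: bsum_ge0 => s _; apply: b2R_ge0.
have X0 : 0 < INR #|X|.
  by apply: lt_0_INR; apply/ltP/card_gt0P; exists 0%R.
exists (INR #|X| / k0); first exact: Rdiv_lt_0_compat.
move=> G; apply: (Rmult_eq_reg_l k0); last lra.
have -> : k0 * (INR #|X| / k0 * \sum_(s : X) b2R (Q s) * G s) = INR #|X| * \sum_(s : X) b2R (Q s) * G s.
  by field; lra.
transitivity (\sum_(a : X) \sum_(b : X) b2R (Q (splice a b)) * G (splice a b)); last first.
  rewrite (sum_splice (fun a _ => b2R (Q a) * G a)) bsum_mulr; apply: eq_bigr => s _.
  by rewrite bsum_const.
rewrite Rmult_comm bsum_mul2; apply: eq_bigr => a _; apply: eq_bigr => b _.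
have -> : Q (splice a b) = Q b.
  by congr (_ == _); apply/ffunP => v; rewrite !ffunE; case: (P v).
case Qb : (Q b) => /=; last by ring.
have -> : splice a b = mask P a; last by ring.
apply/ffunP => v; rewrite !ffunE; case Pv : (P v) => //.
by move/eqP: Qb => /(congr1 (fun s : X => s v)); rewrite !ffunE Pv.
Qed.

(** Ginibre with unchanged couplings and all spins outside [P] pinned to zero. As [y] is pinned,
    [cosq (s x - s y)] becomes [cosq (s x)]: a two-point function is bounded by a magnetization. *)
Lemma wC_freeze c x y : (forall i, 0 <= c i) -> P x -> ~~ P y ->
  wC c x y / wZ c <= (\sum_(s : X) wt c (mask P s) * cosq (mask P s x)) / \sum_(s : X) wt c (mask P s).
Proof.
move=> h Px Py; have c0 := wZ_gt0 c.
have h' i : 0 <= c i <= c i by have := h i; lra.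
have := ginibre oddq (fun v => ~~ P v) h' diffD diffB (diffD (x, y)) (diffB (x, y)) => /=.
rewrite -/(wZ c) -/(wC c x y) => g.
have [k k0 e] := sum_mask.
rewrite (e (wt c)) (e (fun s => wt c s * cosq (s x))).
move: g; set A := \sum_s _; set B := \sum_s _.
have -> : \sum_(s : X) b2R (mask (fun v => ~~ P v) s == 0%R) * (wt c s * cosq (s x)) = B.
  apply: eq_bigr => s _; case: eqP => [z|_] /=; last by ring.
  rewrite /wt /diff /=.
  suff -> : s y = 0%R by rewrite GRing.subr0.
  by have := congr1 (fun s : X => s y) z; rewrite !ffunE Py.
rewrite -/(\sum_(s : X) b2R (mask (fun v => ~~ P v) s == 0%R) * wt c s) -/A => g.
have A0 : 0 < A.
  rewrite /A (bigD1 (0%R : X)) //=; apply: Rplus_lt_le_0_compat.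
    rewrite (_ : mask _ _ == 0%R); first by rewrite /= Rmult_1_l; apply: exp_pos.
    by apply/eqP/ffunP => v; rewrite !ffunE; case: ifP.
  by apply: bsum_ge0 => s _; apply: Rmult_le_pos; [apply: b2R_ge0|apply: exp_ge0].
apply: (Rmult_le_reg_r (wZ c * A)); first exact: Rmult_lt_0_compat.
have -> : wC c x y / wZ c * (wZ c * A) = wC c x y * A by field; lra.
by have -> : k * B / (k * A) * (wZ c * A) = wZ c * B by field; lra.
Qed.

End Freeze.
End Compare.

#[local] Arguments in_interior : simpl never.
#[local] Arguments J : simpl never.
#[local] Arguments dec : simpl never.

(** * Finite-volume Boltzmann weights on the torus *)

Section Finite.
Variables (q m : nat) (beta : R).
Local Notation NT := m.+2.
Local Notation V := {ffun 'I_3 -> 'I_NT}.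
Local Notation X := {ffun V -> 'I_q.+2}.

Section Hamiltonian.
Variables (o : V) (L : nat).
Hypothesis hL : (2 * L.+2 <= NT)%N.
Local Notation int := (fun v => in_interior L (dec o v)).
Local Notation lf := (lift (q := q) (em o) L).

Lemma hamiltonian_torus nu t : - beta * hamiltonian L nu t =
  \sum_(v : V) \sum_(v' : V) beta * (b2R (in_interior L.+1 (dec o v)) *
   (b2R (in_interior L.+1 (dec o v')) * (J (dec o v) (dec o v') *
    dot (spin L nu t (dec o v)) (spin L nu t (dec o v'))))).
Proof.
have hL1 : (2 * L.+1 <= NT)%N by lia.
rewrite /hamiltonian sumRE (sum_box o _ hL1) Rmult_opp_opp bsum_mulr; apply: eq_bigr => v _.
by rewrite sumRE (sum_box o _ hL1) !bsum_mulr; apply: eq_bigr.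
Qed.

Lemma interior_le1 z : in_interior L z -> in_interior L.+1 z.
Proof. exact: in_interior_le. Qed.

Lemma J_dec' x y : in_interior L (dec o x) -> J (dec o x) (dec o y) = b2R (tadj x y) / 6.
Proof. by apply: J_dec; lia. Qed.

Definition cfree (i : V * V) : R :=
  beta / 6 * b2R [&& in_interior L (dec o i.1), in_interior L (dec o i.2) & tadj i.1 i.2].

Lemma hamiltonian_free (s : X) :
  exp (- beta * hamiltonian L Free (lf s)) = wt cfree s.
Proof.
rewrite hamiltonian_torus /wt pair_big /=; congr exp; apply: eq_bigr => -[x y] _ /=.
rewrite /cfree /diff /spin /lift /=.
case hx : (in_interior L (dec o x)) => /=; last by rewrite /dot /=; ring.
case hy : (in_interior L (dec o y)) => /=; last by rewrite /dot /=; ring.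
rewrite !interior_le1 // J_dec' // !em_dec cosqB /dot /cosq /sinq /=; field.
Qed.

(** Pairs containing an interior spin have the same coupling in the box and in the torus. All other
    pairs join two pinned spins; their constant contributions to the two energies differ by [K],
    which cancels in expectations. *)
Lemma hamiltonian_plus : exists c, forall s : X,
  exp (- beta * hamiltonian L Plus (lf s)) = exp c * wt (ctorus beta) (mask int s).
Proof.
pose K (i : V * V) : R := if int i.1 || int i.2 then 0 else
  beta * (b2R (in_interior L.+1 (dec o i.1)) * (b2R (in_interior L.+1 (dec o i.2)) *
    J (dec o i.1) (dec o i.2))) - beta / 6 * b2R (tadj i.1 i.2).
exists (\sum_i K i) => s.
rewrite hamiltonian_torus /wt -exp_plus pair_big -big_split /=; congr exp.
apply: eq_bigr => -[x y] _ /=; rewrite /K /ctorus /diff /=.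
have sp v : spin L Plus (lf s) (dec o v) = (cosq (mask int s v), sinq (mask int s v)).
  rewrite /spin /lift ffunE; case h : (in_interior L (dec o v)); first by rewrite em_dec.
  by rewrite cosq0 sinq0.
have nb u v : in_interior L (dec o u) -> tadj u v -> in_interior L.+1 (dec o v).
  move=> hu a; have [k [e [he ->]]] := tadj_dec hL (interior_le1 hu) a.
  by apply: nudge_interior => //; lia.
rewrite !sp /dot [fst _]/= [fst _]/= [snd _]/= [snd _]/= -cosqB.
set d := cosq _.
case hx : (in_interior L (dec o x)) => /=.
  rewrite interior_le1 // J_dec' //; case a : (tadj x y) => /=; last by field.
  by rewrite (nb x y) //=; field.
case hy : (in_interior L (dec o y)) => /=.
  rewrite (interior_le1 hy) JC J_dec' // tadjC; case a : (tadj x y) => /=; last by field.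
  by rewrite (nb y x) //=; [field|rewrite tadjC].
have -> : d = 1 by rewrite /d !ffunE hx hy GRing.subrr cosq0.
by ring.
Qed.

End Hamiltonian.

Lemma em_inj_interior (o : V) L x y : (2 * L <= NT)%N ->
  in_interior L x -> in_interior L y -> em o x = em o y -> x = y.
Proof. exact: em_inj. Qed.

Definition cratio nu L F := cgibbs L nu beta q.+2 F / cgibbs L nu beta q.+2 (fun _ => 1).

Lemma cratioE (o : V) nu L F : (2 * L.+3 <= NT)%N ->
  cratio nu L.+1 F =
  (\sum_(s : X) exp (- beta * hamiltonian L.+1 nu (lift (em o) L.+1 s)) * F (lift (em o) L.+1 s)) /
  (\sum_(s : X) exp (- beta * hamiltonian L.+1 nu (lift (em o) L.+1 s))).
Proof.
move=> hL; rewrite /cratio !(@cgibbs_config q V (em o)); try by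
  move=> x y; apply: em_inj_interior; lia.
under [X in _ / (_ * X)]eq_bigr => s _ do rewrite Rmult_1_r.
set B := \sum_s exp _; set A := \sum_s _; set c := (2 * PI) ^ _ / _.
have c0 : 0 < c.
  apply: Rdiv_lt_0_compat; first by apply: pow_lt; have := PI_RGT_0; lra.
  by apply: lt_0_INR; apply/ltP/card_gt0P; exists 0%R.
have B0 : 0 < B.
  rewrite /B (bigD1 (0%R : X)) //=; apply: Rplus_lt_le_0_compat; first exact: exp_pos.
  by apply: bsum_ge0 => s _; apply: exp_ge0.
by field; lra.
Qed.

Lemma cratio_free (o : V) L a b : (2 * L.+3 <= NT)%N ->
  in_interior L.+1 a -> in_interior L.+1 b ->
  cratio Free L.+1 (spin_corr a b) =
  wC q (cfree o L.+1) (em o a) (em o b) / wZ q (cfree o L.+1).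
Proof.
move=> hL ha hb; rewrite (cratioE o) //; congr (_ / _); apply: eq_bigr => s _;
  rewrite hamiltonian_free //; congr (_ * _).
by rewrite /spin_corr /lift ha hb /diff /= cosqB.
Qed.

Lemma cratio_plus (o : V) L : (2 * L.+3 <= NT)%N ->
  cratio Plus L.+1 (fun t => cos (t origin)) =
  (\sum_(s : X) wt (ctorus beta) (mask (fun v => in_interior L.+1 (dec o v)) s) *
     cosq (mask (fun v => in_interior L.+1 (dec o v)) s o)) /
  \sum_(s : X) wt (ctorus beta) (mask (fun v => in_interior L.+1 (dec o v)) s).
Proof.
move=> hL; rewrite (cratioE o) //.
have [c e] := hamiltonian_plus o (hL : (2 * L.+1.+2 <= NT)%N).
have hor : in_interior L.+1 origin by [].
have em0 : em o origin = o.
  by apply/ffunP => l; rewrite ffunE /coord /= (_ : zr m _ = 0%R) ?GRing.addr0 //;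
     case: (nat_of_ord l) => [|[|?]]; apply: val_inj.
have h2 : (2 * L.+1 <= NT)%N by lia.
have doo : in_interior L.+1 (dec o o) by rewrite -{2}em0 (dec_em o h2 hor).
have eN : \sum_(s : X) exp (- beta * hamiltonian L.+1 Plus (lift (em o) L.+1 s)) * cos (lift (em o) L.+1 s origin) =
  exp c * \sum_(s : X) wt (ctorus beta) (mask (fun v => in_interior L.+1 (dec o v)) s) *
     cosq (mask (fun v => in_interior L.+1 (dec o v)) s o).
  rewrite bsum_mulr; apply: eq_bigr => s _; rewrite e Rmult_assoc; congr (_ * (_ * _)).
  by rewrite /lift hor em0 ffunE doo.
rewrite eN; under [X in _ / X]eq_bigr => s _ do rewrite e.
rewrite -bsum_mulr; have := exp_pos c.
set B := \sum_s wt _ _; set A := \sum_s _ => c0.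
have B0 : 0 < B.
  rewrite /B (bigD1 (0%R : X)) //=; apply: Rplus_lt_le_0_compat; first exact: exp_pos.
  by apply: bsum_ge0 => s _; apply: exp_ge0.
by field; lra.
Qed.

End Finite.

#[local] Arguments in_interior : simpl never.
#[local] Arguments dec : simpl never.

Lemma big_flat_map (A B : Type) (f : A -> list B) (l : list A) (F : B -> R) :
  \sum_(x <- flat_map f l) F x = \sum_(a <- l) \sum_(x <- f a) F x.
Proof. by elim: l => [|a l IH]; rewrite ?big_nil // big_cons -IH -big_cat. Qed.

Lemma big_Zrange n (F : Z -> R) :
  \sum_(x <- Zrange n) F x = \sum_(i < 2 * n + 1) F (Z.of_nat i - Z.of_nat n)%ZZ.
Proof.
suff h k : \sum_(x <- List.map (fun i => Z.of_nat i - Z.of_nat n)%ZZ (List.seq 0 k)) F x =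
    \sum_(i < k) F (Z.of_nat i - Z.of_nat n)%ZZ by exact: h.
elim: k => [|k IH]; first by rewrite big_nil big_ord0.
by rewrite seq_S map_app big_cat IH big_ord_recr /= big_cons big_nil Rplus_0_r.
Qed.

Lemma big_box n (F : site -> R) :
  \sum_(z <- box n) F z = \sum_(i < 2 * n + 1) \sum_(j < 2 * n + 1) \sum_(k < 2 * n + 1)
    F (Z.of_nat i - Z.of_nat n, Z.of_nat j - Z.of_nat n, Z.of_nat k - Z.of_nat n)%ZZ.
Proof.
rewrite /box big_flat_map big_Zrange; apply: eq_bigr => i _.
rewrite big_flat_map big_Zrange; apply: eq_bigr => j _.
by rewrite [LHS]big_map big_Zrange.
Qed.

Lemma length_box n : length (box n) = ((2 * n + 1) * (2 * n + 1) * (2 * n + 1))%N.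
Proof.
apply: INR_eq; transitivity (\sum_(z <- box n) 1).
  elim: (box n) => [|z l IH]; first by rewrite big_nil.
  by rewrite big_cons -IH (S_INR (length l)) Rplus_comm.
rewrite big_box; under eq_bigr => i _ do under eq_bigr => j _ do rewrite bsum_const card_ord.
under eq_bigr => i _ do rewrite bsum_const card_ord.
by rewrite bsum_const card_ord !mult_INR; ring.
Qed.

(** * Cube averages in the clock model *)

Section Bound.
Variables (q m : nat) (beta : R).
Hypothesis oddq : odd q.
Hypothesis evenm : ~~ odd m.
Hypothesis beta0 : 0 < beta.
Local Notation NT := m.+2.
Local Notation V := {ffun 'I_3 -> 'I_NT}.
Local Notation idx a b c := ('I_a * 'I_b * 'I_c)%type.
Local Notation ct := (@ctorus m beta).

(** Centred here, [box n] becomes the cube with coordinates from [0] to [2 n] that [ptI]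
    enumerates. *)
Definition corner (n : nat) : V := [ffun _ => inZp n].

Lemma sum_box_pt n (phi : V -> R) : let r := (2 * n + 1)%N in
  \sum_(z <- box n) phi (em (corner n) z) = \sum_(t : idx r r r) phi (ptI m t).
Proof.
move=> r; rewrite big_box -bxsumE; apply: eq_bigr => i _; apply: eq_bigr => j _.
apply: eq_bigr => k _; congr phi; apply/ffunP => l; rewrite !ffunE -zr_nat -zrD /coord.
by case: (nat_of_ord l) => [|[|?]]; rewrite -zr_nat; congr zr; apply: Zplus_minus.
Qed.

Lemma sum_ptI_le a b c (f : V -> R) : (a <= NT)%N -> (b <= NT)%N -> (c <= NT)%N ->
  (forall v, 0 <= f v) -> \sum_(t : idx a b c) f (ptI m t) <= \sum_v f v.
Proof.
move=> ha hb hc f0.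
have inj := ptI_inj ha hb hc.
have -> : \sum_(t : idx a b c) f (ptI m t) = \sum_(v in [set ptI m t | t : idx a b c]) f v.
  by rewrite big_imset //= => x y _ _; apply: inj.
rewrite big_mkcond; apply: bsum_le => v _; case: ifP => _; [exact: Rle_refl|exact: f0].
Qed.

Lemma ctorus_ge0 i : 0 <= ct i.
Proof. by apply: Rmult_le_pos; [lra|apply: b2R_ge0]. Qed.

Lemma wC_le1 x y : wC q ct x y / wZ q ct <= 1.
Proof.
have Z0 := wZ_gt0 q ct; apply: (Rmult_le_reg_r (wZ q ct)) => //.
have -> : wC q ct x y / wZ q ct * wZ q ct = wC q ct x y by field; lra.
rewrite Rmult_1_l; apply: bsum_le => s _; rewrite -[X in _ <= X]Rmult_1_r.
by apply: Rmult_le_compat_l; [apply: exp_ge0|apply: cosq_le1].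
Qed.

(** The free state is the torus with every edge outside the interior deleted, and correlations grow
    with the couplings. *)
Lemma free_le_torus o L a b : (2 * L.+3 <= NT)%N ->
  in_interior L.+1 a -> in_interior L.+1 b ->
  cratio q beta Free L.+1 (spin_corr a b) <= wC q ct (em o a) (em o b) / wZ q ct.
Proof.
move=> hL ha hb; rewrite (cratio_free _ _ o) //; apply: wC_mono => // i; split.
  by apply: Rmult_le_pos; [lra|apply: b2R_ge0].
apply: Rmult_le_compat_l; first lra.
by apply: b2R_le => /and3P[].
Qed.

Lemma free_mono L L' a b : (2 * L'.+3 <= NT)%N -> (L <= L')%N ->
  in_interior L.+1 a -> in_interior L.+1 b ->
  cratio q beta Free L.+1 (spin_corr a b) <= cratio q beta Free L'.+1 (spin_corr a b).
Proof.
move=> hL LL ha hb; have le z : in_interior L.+1 z -> in_interior L'.+1 z.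
  by apply: in_interior_le; lia.
rewrite !(cratio_free _ _ (corner 0)) //; try (exact: le); last by lia.
apply: wC_mono => // i; split.
  by apply: Rmult_le_pos; [lra|apply: b2R_ge0].
apply: Rmult_le_compat_l; first lra.
by apply: b2R_le => /and3P[h1 h2 h3]; apply/and3P; split=> //; apply: le.
Qed.

(** If [y] lies outside the box around [x], freezing everything outside that box leaves the plus
    magnetization at its centre; otherwise 1 bounds the correlation. Translation invariance is
    supplied by centring the embedding at [x]. *)
Lemma torus_le_plus RR eta x y : (2 * RR.+3 <= NT)%N -> 0 <= eta ->
  cratio q beta Plus RR.+1 (fun t => cos (t origin)) <= eta ->
  wC q ct x y / wZ q ct <= eta + b2R (in_interior RR.+1 (dec x y)).
Proof.
move=> hR eta0 hm; case hy : (in_interior RR.+1 (dec x y)) => /=.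
  by have := wC_le1 x y; lra.
rewrite Rplus_0_r; apply: Rle_trans hm; rewrite (cratio_plus _ _ x) //.
apply: wC_freeze => //; rewrite ?hy //; first exact: ctorus_ge0.
have h2 : (2 * RR.+1 <= NT)%N by lia.
have em0 : em x origin = x.
  apply/ffunP => l; rewrite ffunE /coord /= (_ : zr m _ = 0%R) ?GRing.addr0 //.
  by case: (nat_of_ord l) => [|[|?]]; apply: val_inj.
by rewrite -{2}em0 (dec_em x h2 (isT : in_interior RR.+1 origin)).
Qed.

(** In the cube of side [M], each point has at most [length (box RR)] partners at short range and
    correlation at most [eta] with the others. [torus_average] carries the resulting bound down to
    side [r], and free correlations lie below those of the torus. *)
Lemma clock_bound RR eta n K L al : let r := (2 * n + 1)%N in let M := (2 ^ K * r)%N in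
  (2 * RR.+3 <= NT)%N -> (2 * L.+3 <= NT)%N -> (M <= NT)%N -> (n <= L)%N ->
  0 < eta -> cratio q beta Plus RR.+1 (fun t => cos (t origin)) <= eta ->
  0 < al -> eta + INR (length (box RR)) / INR (M * M * M) <= al ^ 2 ->
  / INR (length (box n)) ^ 2 * sumR (box n) (fun x => sumR (box n) (fun y =>
     cratio q beta Free L.+1 (spin_corr x y))) <= 2 * (al + 6 * kap (beta / 6) r) ^ 2.
Proof.
move=> r M hR hL hM nL eta0 hmag al0 hal.
have Z0 := wZ_gt0 q ct.
have r0 : (0 < r)%N by rewrite /r; lia.
have M0 : (0 < M)%N by rewrite /M muln_gt0 expn_gt0 r0.
have pos3 (a : nat) : (0 < a)%N -> 0 < INR (a * a * a).
  by move=> a0; apply: lt_0_INR; apply/ltP; rewrite !muln_gt0 a0.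
have IM := pos3 _ M0.
have eZ : \sum_(s : {ffun V -> 'I_q.+2}) W (@cosq q) (@sinq q) (@tadj m) (beta / 6) s = wZ q ct.
  by apply: eq_bigr => s _; rewrite W_torus.
have b6 : 0 < beta / 6 by lra.
have key : / INR (M * M * M) ^ 2 * (\sum_(t : idx M M M) \sum_(t' : idx M M M)
    corr (beta / 6) (@cosq q) (@sinq q) (ptI m t) (ptI m t')) <= al ^ 2 * wZ q ct.
  have row t : \sum_(t' : idx M M M) corr (beta / 6) (@cosq q) (@sinq q) (ptI m t) (ptI m t') <=
     (INR (M * M * M) * eta + INR (length (box RR))) * wZ q ct.
    set x := ptI m t.
    apply: (Rle_trans _ (\sum_(t' : idx M M M) (eta + b2R (in_interior RR.+1 (dec x (ptI m t')))) * wZ q ct)).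
      apply: bsum_le => t' _; rewrite corr_torus.
      have := torus_le_plus x (ptI m t') hR (Rlt_le _ _ eta0) hmag.
      move/(Rmult_le_compat_r _ _ _ (Rlt_le _ _ Z0)).
      by have -> : wC q ct x (ptI m t') / wZ q ct * wZ q ct = wC q ct x (ptI m t') by field; lra.
    rewrite -bsum_mull; apply: Rmult_le_compat_r; first lra.
    rewrite big_split /= bsum_const card_idx; apply: Rplus_le_compat_l.
    apply: (Rle_trans _ _ _ (sum_ptI_le hM hM hM (fun v => b2R_ge0 (in_interior RR.+1 (dec x v))))).
    have := @sum_box m x RR (fun _ => 1) ltac:(lia).
    rewrite (_ : \sum_(k <- box RR) 1 = INR (length (box RR))); last first.
      elim: (box RR) => [|z l IH]; first by rewrite big_nil.
      by rewrite big_cons IH (S_INR (length l)) Rplus_comm.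
    by move=> ->; right; apply: eq_bigr => v _; rewrite Rmult_1_r.
  apply: (Rle_trans _ (/ INR (M * M * M) ^ 2 * (INR (M * M * M) *
     ((INR (M * M * M) * eta + INR (length (box RR))) * wZ q ct)))).
    apply: Rmult_le_compat_l; first by left; apply: Rinv_0_lt_compat; apply: pow_lt.
    apply: (Rle_trans _ (\sum_(t : idx M M M) (INR (M * M * M) * eta + INR (length (box RR))) * wZ q ct)).
      by apply: bsum_le => t _; apply: row.
    by rewrite bsum_const card_idx; lra.
  have -> : / INR (M * M * M) ^ 2 * (INR (M * M * M) *
     ((INR (M * M * M) * eta + INR (length (box RR))) * wZ q ct)) =
     (eta + INR (length (box RR)) / INR (M * M * M)) * wZ q ct by field; lra.
  by apply: Rmult_le_compat_r; lra.
have := @torus_average m _ (beta / 6) (ord0 : 'I_q.+2) evenm b6 (@cosq q) (@sinq q)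
  (@cosq_sinq q) K r al r0 hM al0.
rewrite eZ => /(_ key) h.
apply: (Rmult_le_reg_r (wZ q ct)) => //; apply: Rle_trans h.
have lb : length (box n) = (r * r * r)%N by rewrite length_box.
rewrite lb Rmult_assoc; apply: Rmult_le_compat_l.
  left; apply: Rinv_0_lt_compat; apply: pow_lt; exact: pos3.
have hn z : List.In z (box n) -> in_interior L.+1 z.
  by move/in_interiorE; apply: in_interior_le.
have le_list (l : list site) (F G : site -> R) : (forall z, List.In z l -> F z <= G z) ->
    sumR l F <= \sum_(z <- l) G z.
  elim: l => [|z l IH] hl; first by rewrite big_nil /=; lra.
  rewrite big_cons /=; apply: Rplus_le_compat; first by apply: hl; left.
  by apply: IH => u hu; apply: hl; right.
rewrite -(sum_box_pt n (fun v => \sum_(t' : idx r r r) corr (beta / 6) (@cosq q) (@sinq q) v (ptI m t'))).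
apply: (Rle_trans _ ((\sum_(z <- box n) \sum_(z' <- box n)
   wC q ct (em (corner n) z) (em (corner n) z') / wZ q ct) * wZ q ct)).
  apply: Rmult_le_compat_r; first lra.
  apply: (le_list) => z hz; apply: (le_list) => z' hz'.
  by apply: free_le_torus => //; apply: hn.
rewrite bsum_mull; right; apply: eq_bigr => z _.
rewrite -(sum_box_pt n (fun v => corr (beta / 6) (@cosq q) (@sinq q) _ v)) bsum_mull.
by apply: eq_bigr => z' _; rewrite corr_torus; field; lra.
Qed.

End Bound.

(** * Passage to the continuum and conclusion *)

Lemma is_lim_seq_sumR (A : Type) (l : list A) (u : nat -> A -> R) (v : A -> R) :
  (forall a, List.In a l -> is_lim_seq (fun n => u n a) (v a)) ->
  is_lim_seq (fun n => sumR l (u n)) (sumR l v).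
Proof.
elim: l => [|a l IH] h /=; first exact: is_lim_seq_const.
by apply: is_lim_seq_plus'; [apply: h; left|apply: IH => b hb; apply: h; right].
Qed.

(** [cratio] adds 2 to its first argument, so [p.*2.+1] selects clocks with an odd number of
    angles. *)
Lemma cratio_lim beta nu L F : blip (box L) F ->
  is_lim_seq (fun p => cratio (p.*2.+1) beta nu L F) (gibbs beta nu L F / partition beta nu L).
Proof.
move=> hF; have h := @cgibbs_ratio_lim L nu beta F hF.
apply: (is_lim_seq_subseq _ _ (fun p => p.*2.+2) _ h).
by apply: eventually_subseq => p; rewrite doubleS; apply/ltP; lia.
Qed.

Lemma csum_le q sites f g t : (0 < q)%N -> (forall u, f u <= g u) -> csum q sites f t <= csum q sites g t.
Proof.
move=> q0 h; elim: sites t => [|k s IH] t; first exact: h.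
rewrite !csum_cons; apply: Rmult_le_compat_l; last by apply: bsum_le => i _; apply: IH.
by apply: Rmult_le_pos; [exact: PI2_ge0|left; apply: Rinv_0_lt_compat; apply: lt_0_INR; apply/ltP].
Qed.

Lemma csum_linear q sites c f g t :
  csum q sites (fun u => c * f u + g u) t = c * csum q sites f t + csum q sites g t.
Proof.
elim: sites t => [//|k s IH] t; rewrite !csum_cons.
under eq_bigr => i _ do rewrite IH.
rewrite big_split /= -bsum_mulr; ring.
Qed.

(** * Order and linearity of Gibbs integrals *)

Section Gibbs.
Variables (nu : bc) (L : nat).
Local Notation blipL := (blip (box L)).

(** Inherited from clock sums, where it holds term by term. Two inverse temperatures are allowed so
    that nearby Gibbs states can be compared. *)
Lemma gibbs_le beta beta' F G c : blipL F -> blipL G ->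
  (forall t, exp (- beta * hamiltonian L nu t) * F t <= c * (exp (- beta' * hamiltonian L nu t) * G t)) ->
  gibbs beta nu L F <= c * gibbs beta' nu L G.
Proof.
move=> hF hG h.
have lF := @cgibbs_lim L nu beta F hF; have lG := is_lim_seq_scal_l _ c _ (@cgibbs_lim L nu beta' G hG).
refine (is_lim_seq_le _ _ _ _ _ lF lG) => n.
apply: (Rle_trans _ (csum n.+1 (box (L - 1)) (fun t => c * (exp (- beta' * hamiltonian L nu t) * G t) + 0) (fun _ => 0))).
  by apply: csum_le => // u; rewrite Rplus_0_r.
rewrite csum_linear /cgibbs.
have -> : csum n.+1 (box (L - 1)) (fun _ => 0) (fun _ => 0) = 0; last by lra.
elim: (box (L - 1)) (fun _ : site => 0) => [//|k s IH] t; rewrite csum_cons big1 ?Rmult_0_r //.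
Qed.

Lemma gibbs_add beta F G : blipL F -> blipL G ->
  gibbs beta nu L (fun t => F t + G t) = gibbs beta nu L F + gibbs beta nu L G.
Proof.
move=> hF hG.
have l := @cgibbs_lim L nu beta _ (blip_add hF hG).
have l' := is_lim_seq_plus' _ _ _ _ (@cgibbs_lim L nu beta F hF) (@cgibbs_lim L nu beta G hG).
have e n : cgibbs L nu beta n.+1 F + cgibbs L nu beta n.+1 G = cgibbs L nu beta n.+1 (fun t => F t + G t).
  rewrite /cgibbs -[X in X + _ = _]Rmult_1_l -csum_linear; congr csum.
  by apply: functional_extensionality => t; ring.
have := is_lim_seq_unique _ _ (is_lim_seq_ext _ _ _ e l').
by rewrite (is_lim_seq_unique _ _ l) => -[].
Qed.

Lemma gibbs0 beta : gibbs beta nu L (fun _ => 0) = 0.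
Proof.
have := gibbs_add beta (blip_const (box L) 0) (blip_const (box L) 0).
by rewrite Rplus_0_r; lra.
Qed.

Lemma gibbs_sumR beta (A : Type) (l : list A) (F : A -> (site -> R) -> R) :
  (forall a, List.In a l -> blipL (F a)) ->
  blipL (fun t => sumR l (fun a => F a t)) /\
  gibbs beta nu L (fun t => sumR l (fun a => F a t)) = sumR l (fun a => gibbs beta nu L (F a)).
Proof.
elim: l => [|a l IH] h /=; first by split; [exact: blip_const|exact: gibbs0].
have [h1 h2] := IH (fun b hb => h b (or_intror hb)); have ha := h a (or_introl erefl).
by split; [exact: blip_add|rewrite gibbs_add // h2].
Qed.

Lemma partition_gt0 beta : 0 < partition beta nu L.
Proof. exact: gibbs_one_gt0. Qed.

Lemma gibbs_ratio_le1 beta F : blipL F -> (forall t, F t <= 1) -> gibbs beta nu L F / partition beta nu L <= 1.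
Proof.
move=> hF h; have P0 := partition_gt0 beta.
apply: (Rmult_le_reg_r (partition beta nu L)) => //.
have -> : gibbs beta nu L F / partition beta nu L * partition beta nu L = gibbs beta nu L F by field; lra.
apply: gibbs_le => //; first exact: blip_const.
move=> t; rewrite Rmult_1_l; apply: Rmult_le_compat_l => //; exact: exp_ge0.
Qed.

End Gibbs.

Definition corrL beta L x y := gibbs beta Free L (spin_corr x y) / partition beta Free L.

Lemma spin_corr_le1 x y t : spin_corr x y t <= 1.
Proof. by rewrite /spin_corr -cos_minus; have [] := COS_bound (t x - t y). Qed.

Lemma in_box_le n L z : (n <= L)%N -> List.In z (box n) -> List.In z (box L).
Proof. by move=> h /in_interiorE hz; apply/in_interiorE; apply: in_interior_le hz. Qed.

Definition msum n (f : site -> site -> R) : R := sumR (box n) (fun x => sumR (box n) (f x)).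

Definition total_spin2 n (t : site -> R) : R := msum n (fun x y => spin_corr x y t).

Lemma sumR_mulr (A : Type) (l : list A) c F : sumR l (fun a => c * F a) = c * sumR l F.
Proof. by elim: l => [|a l IH] /=; [ring|rewrite IH; ring]. Qed.

Lemma sumR_mull (A : Type) (l : list A) c F : sumR l (fun a => F a * c) = sumR l F * c.
Proof. by elim: l => [|a l IH] /=; [ring|rewrite IH; ring]. Qed.

Lemma sumR_ext_in (A : Type) (l : list A) F G :
  (forall a, List.In a l -> F a = G a) -> sumR l F = sumR l G.
Proof.
elim: l => [//|a l IH] h /=; rewrite (h a); last by left.
by rewrite IH // => b hb; apply: h; right.
Qed.

Lemma sumR_add (A : Type) (l : list A) F G : sumR l (fun a => F a + G a) = sumR l F + sumR l G.
Proof. by elim: l => [|a l IH] /=; [ring|rewrite IH; ring]. Qed.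

(** The double sum is the squared length of the total spin. Unlike a single [spin_corr] it has a
    sign, so a change of Boltzmann factor can be estimated pointwise. *)
Lemma total_spin2_ge0 n t : 0 <= total_spin2 n t.
Proof.
have e x : sumR (box n) (fun y => spin_corr x y t) =
    cos (t x) * sumR (box n) (fun y => cos (t y)) + sin (t x) * sumR (box n) (fun y => sin (t y)).
  by rewrite /spin_corr sumR_add !sumR_mulr.
rewrite /total_spin2 /msum !sumRE; under eq_bigr => x _ do rewrite e.
rewrite -sumRE sumR_add !sumR_mull.
by have := Rle_0_sqr (sumR (box n) (fun y => cos (t y)));
   have := Rle_0_sqr (sumR (box n) (fun y => sin (t y))); rewrite /Rsqr; lra.
Qed.

Lemma gibbs_total_spin2 beta n L : (n <= L)%N -> blip (box L) (total_spin2 n) /\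
  gibbs beta Free L (total_spin2 n) = msum n (corrL beta L) * partition beta Free L.
Proof.
move=> nL; have hb x y : List.In x (box n) -> List.In y (box n) -> blip (box L) (spin_corr x y).
  by move=> hx hy; apply: blip_spin_corr; apply: in_box_le; eassumption.
have h1 x : List.In x (box n) -> blip (box L) (fun t => sumR (box n) (fun y => spin_corr x y t)) /\
    gibbs beta Free L (fun t => sumR (box n) (fun y => spin_corr x y t)) =
    sumR (box n) (fun y => gibbs beta Free L (spin_corr x y)).
  by move=> hx; apply: gibbs_sumR => y hy; apply: hb.
have [h2 h3] := @gibbs_sumR Free L beta _ (box n) (fun x t => sumR (box n) (fun y => spin_corr x y t))
  (fun x hx => (h1 x hx).1).
split=> //; rewrite /total_spin2 /msum h3.
have P0 := partition_gt0 Free L beta.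
rewrite -sumR_mull; apply: sumR_ext_in => x hx; rewrite (h1 x hx).2 -sumR_mull.
by apply: sumR_ext_in => y hy; rewrite /corrL; field; lra.
Qed.

Lemma corrL_mono beta L L' x y : 0 < beta -> (L <= L')%N ->
  List.In x (box L) -> List.In y (box L) -> corrL beta L.+1 x y <= corrL beta L'.+1 x y.
Proof.
move=> b0 LL hx hy.
have le K : (L <= K)%N -> blip (box K.+1) (spin_corr x y).
  by move=> LK; apply: blip_spin_corr; [apply: in_box_le hx|apply: in_box_le hy]; lia.
have l1 := @cratio_lim beta Free L.+1 _ (le L (leqnn L)).
have l2 := @cratio_lim beta Free L'.+1 _ (le L' LL).
refine (is_lim_seq_le _ _ _ _ _ l1 l2) => p.
have o1 : odd p.*2.+1 by rewrite /= odd_double.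
have o2 : ~~ odd (L'.+2).*2 by rewrite odd_double.
apply: (free_mono o1 o2 b0 _ LL); first by lia.
- exact/in_interiorE.
- exact/in_interiorE.
Qed.

(** * Bounds uniform in the volume, below and at the critical point *)

Lemma continuum_bound beta RR eta n K L al : let r := (2 * n + 1)%N in let M := (2 ^ K * r)%N in
  0 < beta -> (n <= L)%N -> 0 < eta ->
  gibbs beta Plus RR.+1 (fun t => cos (t origin)) / partition beta Plus RR.+1 < eta ->
  0 < al -> eta + INR (length (box RR)) / INR (M * M * M) <= al ^ 2 ->
  / INR (length (box n)) ^ 2 * msum n (corrL beta L.+1) <= 2 * (al + 6 * kap (beta / 6) r) ^ 2.
Proof.
move=> r M b0 nL eta0 hmag al0 hal.
have h0 : List.In origin (box RR.+1) by apply/in_interiorE.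
have lp := @cratio_lim beta Plus RR.+1 _ (blip_cos h0).
have lf : is_lim_seq (fun p => / INR (length (box n)) ^ 2 *
   msum n (fun x y => cratio (p.*2.+1) beta Free L.+1 (spin_corr x y)))
   (/ INR (length (box n)) ^ 2 * msum n (corrL beta L.+1)).
  apply: (is_lim_seq_scal_l _ (/ INR (length (box n)) ^ 2) (msum n (corrL beta L.+1))).
  apply: is_lim_seq_sumR => x hx; apply: is_lim_seq_sumR => y hy.
  by apply: cratio_lim; apply: blip_spin_corr; [apply: in_box_le hx|apply: in_box_le hy]; lia.
(* The torus, of even side [m.+2], has room for the plus box, the free box and the cube of side [M]
   at once. *)
pose m := (RR.+3 + L.+3 + M).*2.
have ev : eventually (fun p => / INR (length (box n)) ^ 2 *
   msum n (fun x y => cratio (p.*2.+1) beta Free L.+1 (spin_corr x y)) <=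
   2 * (al + 6 * kap (beta / 6) r) ^ 2).
  have d0 : 0 < eta - gibbs beta Plus RR.+1 (fun t => cos (t origin)) / partition beta Plus RR.+1 by lra.
  move/is_lim_seq_spec: lp => /(_ (mkposreal _ d0)) [p0 hp]; exists p0 => p /hp /= /Rabs_lt_between [_ h].
  have o1 : odd p.*2.+1 by rewrite /= odd_double.
  have o2 : ~~ odd m by rewrite /m odd_double.
  apply: (@clock_bound p.*2.+1 m beta o1 o2 b0 RR eta n K L al) => //.
  - by rewrite /m; lia.
  - by rewrite /m; lia.
  - by rewrite -/r -/M /m; lia.
  - lra.
exact: (is_lim_seq_le_loc _ _ _ _ ev lf (is_lim_seq_const _)).
Qed.

(** [Lim_seq] is total: it is at least [eta] if all the ratios are. Since [real] sends infinite
    values to 0, the bound by 1 is what excludes a limit [p_infty] here. *)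
Lemma magnetization_small beta eta : magnetization beta = 0 -> 0 < eta ->
  exists RR, gibbs beta Plus RR.+1 (fun t => cos (t origin)) / partition beta Plus RR.+1 < eta.
Proof.
move=> h0 eta0.
pose u n := gibbs beta Plus n.+1 (fun t => cos (t origin)) / partition beta Plus n.+1.
have u1 n : u n <= 1.
  apply: gibbs_ratio_le1 => [|t]; last by have [] := COS_bound (t origin).
  by apply: blip_cos; apply/in_interiorE.
case: (classic (exists RR, u RR < eta)) => // hn; exfalso.
have ge n : eta <= u n by case: (Rle_lt_dec eta (u n)) => // ?; case: hn; exists n.
have l1 := Lim_seq_le_loc (fun _ => eta) u (ex_intro _ 0%N (fun n _ => ge n)).
have l2 := Lim_seq_le_loc u (fun _ => 1) (ex_intro _ 0%N (fun n _ => u1 n)).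
move: h0 l1 l2; rewrite /magnetization /expect -/u !Lim_seq_const.
by case: (Lim_seq u) => [x /= -> h1 _|_ _ []|_ []]; apply: (Rlt_not_le _ _ eta0 h1).
Qed.

(* Any fixed multiple of [kap] can serve as the bound for the large blocks, since the
   magnetization vanishes and the blocks may be taken arbitrarily large. *)
Lemma subcritical_bound beta n L : 0 < beta -> magnetization beta = 0 -> (n <= L)%N ->
  / INR (length (box n)) ^ 2 * msum n (corrL beta L.+1) <= 588 / (beta * INR (2 * n + 1)).
Proof.
move=> b0 mag nL; set r := (2 * n + 1)%N.
have r0 : 0 < INR r by apply: lt_0_INR; apply/ltP; rewrite /r; lia.
have br : 0 < INR r * (beta / 6) by nra.
have s0 := sqrt_lt_R0 _ br.
pose al := kap (beta / 6) r.
have al0 : 0 < al by apply: Rinv_0_lt_compat.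
have al2 : 0 < al ^ 2 by apply: pow_lt.
have eal : al ^ 2 = 6 / (beta * INR r).
  by rewrite /al /kap pow_inv pow2_sqrt; [field; lra|lra].
(* Half of [al ^ 2] is spent on distant pairs and half on near ones; for the latter, [K < 2 ^ K]
   makes the large cube big enough. *)
have [RR hR] := magnetization_small mag (ltac:(lra) : 0 < al ^ 2 / 2).
have [K hK] := INR_unbounded (INR (length (box RR)) / (al ^ 2 / 2)).
have := @continuum_bound beta RR (al ^ 2 / 2) n K L al b0 nL ltac:(lra) hR al0.
rewrite -/r -/al => h; apply: Rle_trans (h _) _; last first.
  (* Here [98 = 2 * 7^2], and [588 = 98 * 6] with the 6 from [al ^ 2 = 6 / (beta * INR r)]. *)
  right; have -> : 2 * (al + 6 * al) ^ 2 = 98 * al ^ 2 by ring.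
  by rewrite eal; field; lra.
set M := (2 ^ K * r)%N.
have KM : INR K <= INR (M * M * M).
  apply: le_INR; apply/leP; have K2 : (K < 2 ^ K)%N by apply: ltn_expl.
  have KM : (K <= M)%N by rewrite /M /r; nia.
  have M1 : (1 <= M)%N by rewrite /M /r; nia.
  by clearbody M; nia.
have l0 : 0 <= INR (length (box RR)) by apply: pos_INR.
have K0 : 0 < INR K.
  by apply: Rle_lt_trans hK; apply: Rdiv_le_0_compat => //; lra.
suff : INR (length (box RR)) / INR (M * M * M) <= al ^ 2 / 2 by lra.
apply: (Rmult_le_reg_r (INR (M * M * M))); first lra.
have -> : INR (length (box RR)) / INR (M * M * M) * INR (M * M * M) = INR (length (box RR)) by field; lra.
have hK' : INR (length (box RR)) < INR K * (al ^ 2 / 2).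
  have := Rmult_lt_compat_r _ _ _ (ltac:(lra) : 0 < al ^ 2 / 2) hK.
  by have -> : INR (length (box RR)) / (al ^ 2 / 2) * (al ^ 2 / 2) = INR (length (box RR)) by field; lra.
nra.
Qed.

Lemma exp_monotone x y : x <= y -> exp x <= exp y.
Proof. by case=> [h|->]; [left; apply: exp_increasing|right]. Qed.

(* The energy of a finite box is bounded, so the finite volume states depend continuously on
   the inverse temperature; the bound below the critical point thus extends to it. *)
Lemma critical_bound beta_c n L : 0 < beta_c ->
  (forall beta, 0 <= beta < beta_c -> magnetization beta = 0) -> (n <= L)%N ->
  / INR (length (box n)) ^ 2 * msum n (corrL beta_c L.+1) <= 2352 / beta_c * / INR (2 * n + 1).
Proof.
move=> bc0 mag nL.
have r0 : 0 < INR (2 * n + 1) by apply: lt_0_INR; apply/ltP; lia.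
have [K [C [_ C0 hC]]] := blip_hamiltonian L.+1 Free (-1).
have H t : - C <= hamiltonian L.+1 Free t <= C.
  by have /Rabs_le_between := hC t; lra.
(* The first bound keeps [beta] at least [beta_c / 2]. The second gives [d * C <= 1/4]: the
   numerator and the partition function each lose a factor [exp (d * C)], together at most 2. *)
pose d := Rmin (beta_c / 2) (/ (4 * (C + 1))).
have d0 : 0 < d by apply: Rmin_glb_lt; [lra|apply: Rinv_0_lt_compat; lra].
have d1 : d <= beta_c / 2 by apply: Rmin_l.
have d2 : 2 * (d * C) <= / 2.
  have h : d * (4 * (C + 1)) <= 1.
    apply: (Rle_trans _ (/ (4 * (C + 1)) * (4 * (C + 1)))); last by right; field; lra.
    by apply: Rmult_le_compat_r; [lra|apply: Rmin_r].
  by nra.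
have dC0 : 0 <= d * C by nra.
pose beta := beta_c - d; have b0 : 0 < beta by rewrite /beta; lra.
have mb : magnetization beta = 0 by apply: mag; rewrite /beta; lra.
have nL1 : (n <= L.+1)%N by lia.
have [hF eF] := gibbs_total_spin2 beta nL1.
have [_ eFc] := gibbs_total_spin2 beta_c nL1.
have P0 := partition_gt0 Free L.+1 beta; have Pc0 := partition_gt0 Free L.+1 beta_c.
have g1 : gibbs beta_c Free L.+1 (total_spin2 n) <= exp (d * C) * gibbs beta Free L.+1 (total_spin2 n).
  apply: gibbs_le => // t; rewrite -Rmult_assoc -exp_plus; apply: Rmult_le_compat_r.
    exact: total_spin2_ge0.
  by apply: exp_monotone; have := H t; rewrite /beta; nra.
have g2 : partition beta Free L.+1 <= exp (d * C) * partition beta_c Free L.+1.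
  apply: gibbs_le => [||t]; [exact: blip_const|exact: blip_const|].
  rewrite !Rmult_1_r -exp_plus; apply: exp_monotone; have := H t; rewrite /beta; nra.
have e2 : exp (d * C) * exp (d * C) <= 2.
  rewrite -exp_plus; apply: (Rle_trans _ _ _ (@exp_small (d * C + d * C) ltac:(lra))).
  have quad y : 0 <= y <= / 2 -> 1 + y + 2 * y ^ 2 <= 2 by nra.
  by apply: quad; lra.
set A := msum n (corrL beta L.+1) in eF; set Ac := msum n (corrL beta_c L.+1) in eFc *.
have A0 : 0 <= A.
  apply: (Rmult_le_reg_r (partition beta Free L.+1)) => //; rewrite Rmult_0_l -eF.
  have := @gibbs_le Free L.+1 beta beta (fun _ => 0) (total_spin2 n) 1 (blip_const _ 0) hF.
  rewrite gibbs0 Rmult_1_l; apply=> t; rewrite Rmult_0_r Rmult_1_l.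
  by apply: Rmult_le_pos; [exact: exp_ge0|exact: total_spin2_ge0].
have AcA : Ac <= 2 * A.
  apply: (Rmult_le_reg_r (partition beta_c Free L.+1)) => //; rewrite -eFc.
  apply: (Rle_trans _ _ _ g1); rewrite eF.
  apply: (Rle_trans _ (exp (d * C) * (A * (exp (d * C) * partition beta_c Free L.+1)))).
    apply: Rmult_le_compat_l; first exact: exp_ge0.
    exact: Rmult_le_compat_l.
  have -> : exp (d * C) * (A * (exp (d * C) * partition beta_c Free L.+1)) =
    exp (d * C) * exp (d * C) * (A * partition beta_c Free L.+1) by ring.
  rewrite (Rmult_assoc 2); apply: Rmult_le_compat_r => //; apply: Rmult_le_pos => //; lra.
have hb := subcritical_bound b0 mb nL; rewrite -/A in hb.
have l0 : 0 <= / INR (length (box n)) ^ 2.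
  left; apply: Rinv_0_lt_compat; apply: pow_lt; apply: lt_0_INR; apply/ltP.
  by rewrite length_box !muln_gt0; lia.
apply: (Rle_trans _ (2 * (588 / (beta * INR (2 * n + 1))))).
  apply: (Rle_trans _ (2 * (/ INR (length (box n)) ^ 2 * A))); last lra.
  have -> : 2 * (/ INR (length (box n)) ^ 2 * A) = / INR (length (box n)) ^ 2 * (2 * A) by ring.
  exact: Rmult_le_compat_l.
(* [2352 = 4 * 588]: one factor 2 from the change of temperature, one from replacing [beta] by
   [beta_c / 2]. *)
have -> : 2352 / beta_c * / INR (2 * n + 1) = 2 * (588 / (beta_c / 2 * INR (2 * n + 1))) by field; lra.
apply: Rmult_le_compat_l; first lra; apply: Rmult_le_compat_l; first lra.
apply: Rinv_le_contravar; first by apply: Rmult_lt_0_compat; lra.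
by apply: Rmult_le_compat_r; rewrite /beta; lra.
Qed.

Lemma msum_corrL_ge0 beta n L : (n <= L)%N -> 0 <= msum n (corrL beta L).
Proof.
move=> nL; have [hF eF] := gibbs_total_spin2 beta nL.
apply: (Rmult_le_reg_r _ _ _ (partition_gt0 Free L beta)); rewrite Rmult_0_l -eF.
have := @gibbs_le Free L beta beta (fun _ => 0) (total_spin2 n) 1 (blip_const _ 0) hF.
rewrite gibbs0 Rmult_1_l; apply=> t; rewrite Rmult_0_r Rmult_1_l.
by apply: Rmult_le_pos; [exact: exp_ge0|exact: total_spin2_ge0].
Qed.

(** Free correlations increase with the volume and are bounded by 1, so the [Lim_seq] inside
    [expect] is a genuine limit. Starting at volume [n.+1] places [box n] in the interior. *)
Lemma expect_free_lim beta n x y : 0 < beta -> List.In x (box n) -> List.In y (box n) ->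
  is_lim_seq (fun k => corrL beta (k + n).+1 x y) (expect beta Free (spin_corr x y)).
Proof.
move=> b0 hx hy.
have ex : ex_finite_lim_seq (fun k => corrL beta (k + n).+1 x y).
  apply: (ex_finite_lim_seq_incr _ 1) => k.
    apply: (corrL_mono b0); [by rewrite leq_add2r|apply: in_box_le hx|apply: in_box_le hy];
      exact: leq_addl.
  apply: gibbs_ratio_le1; last exact: spin_corr_le1.
  by apply: blip_spin_corr; [apply: in_box_le hx|apply: in_box_le hy]; lia.
have := Lim_seq_correct' _ ex.
by rewrite (Lim_seq_incr_n (fun k => corrL beta k.+1 x y) n).
Qed.

Theorem theorem2p1 :
  forall beta_c : R,
    0 < beta_c ->
    (forall beta : R, 0 <= beta < beta_c -> magnetization beta = 0) ->
    (forall beta : R, beta_c < beta -> 0 < magnetization beta) ->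
    is_lim_seq
      (fun n : nat =>
         / (INR (length (box (S n)))) ^ 2 *
         sumR (box (S n)) (fun x => sumR (box (S n)) (fun y =>
           expect beta_c Free (spin_corr x y))))
      0.
Proof.
move=> beta_c bc0 mag _.
have lim n : is_lim_seq (fun k => / INR (length (box n)) ^ 2 * msum n (corrL beta_c (k + n).+1))
    (/ INR (length (box n)) ^ 2 * msum n (fun x y => expect beta_c Free (spin_corr x y))).
  apply: (is_lim_seq_scal_l _ (/ INR (length (box n)) ^ 2)
    (msum n (fun x y => expect beta_c Free (spin_corr x y)))).
  apply: is_lim_seq_sumR => x hx; apply: is_lim_seq_sumR => y hy.
  exact: expect_free_lim.
have le k n : (n <= k + n)%N by lia.
have c0 : 0 <= 2352 / beta_c by left; apply: Rdiv_lt_0_compat; lra.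
have lC : is_lim_seq (fun n => 2352 / beta_c * / INR n.+1) 0.
  have l0 : is_lim_seq (fun n => / INR n.+1) 0.
    apply/(is_lim_seq_incr_1 (fun n => / INR n)).
    exact: (is_lim_seq_inv _ p_infty is_lim_seq_INR).
  by have := is_lim_seq_scal_l _ (2352 / beta_c) _ l0; rewrite /= Rmult_0_r.
apply: is_lim_seq_le_le (is_lim_seq_const 0) lC => n; split.
  refine (is_lim_seq_le _ _ _ _ _ (is_lim_seq_const 0) (lim n.+1)) => k.
  apply: Rmult_le_pos; last by apply: msum_corrL_ge0; lia.
  left; apply: Rinv_0_lt_compat; apply: pow_lt; apply: lt_0_INR; apply/ltP.
  by rewrite length_box !muln_gt0; lia.
have h : / INR (length (box n.+1)) ^ 2 * msum n.+1 (fun x y => expect beta_c Free (spin_corr x y)) <=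
    2352 / beta_c * / INR (2 * n.+1 + 1).
  (* The bound at the critical point is the same for all volumes [k], hence it passes to the
     infinite-volume limit. *)
  refine (is_lim_seq_le _ _ _ _ _ (lim n.+1) (is_lim_seq_const _)) => k.
  exact: (critical_bound bc0 mag (le k n.+1)).
apply: (Rle_trans _ _ _ h); apply: Rmult_le_compat_l => //.
apply: Rinv_le_contravar; first by apply: lt_0_INR; apply/ltP.
by apply: le_INR; apply/leP; lia.
Qed.
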